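(* Let $a\ge 1$, $b$, $k$ be integers with $2\le k\le b$, let $\mathrm{h}=(a,1^b)$ and $\mathrm{h}(k)=(a+k,1^{b-k})$, and let $r=a+b$. If $n\ge b+1$, then $$\mathrm{Ext}^1_{S(n,r)}(\Delta(\mathrm{h}),\Delta(\mathrm{h}(k)))=0$$ unless $a+b+k$ is odd, in which case $$\mathrm{Ext}^1_{S(n,r)}(\Delta(\mathrm{h}),\Delta(\mathrm{h}(k)))\cong\mathbb{Z}_2 .$$
   Context: $S(n,r)=S_{\mathbb{Z}}(n,r)$ denotes the integral Schur algebra; its modules are the homogeneous polynomial representations of $GL_n(\mathbb{Z})$ of degree $r$. For a partition $\lambda$ of $r$ with at most $n$ parts, $\Delta(\lambda)$ is the (integral) Weyl module of $S(n,r)$ of highest weight $\lambda$. With $F=\mathbb{Z}^n$, $D_a=D_aF$ the divided power and $\wedge^b=\wedge^bF$ the exterior power, one has $\Delta((a))=D_a$, $\Delta((1^b))=\wedge^b$, and for a hook $(a,1^b)$ with $b\ge1$, $\Delta(a,1^b)$ is the cokernel of the composite $D_{a+1}\otimes\wedge^{b-1}\to D_a\otimes D_1\otimes\wedge^{b-1}\to D_a\otimes\wedge^b$ of comultiplication (on the first factor) and multiplication (of $D_1=\wedge^1$ with $\wedge^{b-1}$). $\mathbb{Z}_m=\mathbb{Z}/m\mathbb{Z}$. All tensor products are over $\mathbb{Z}$. *)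

(* Defs.v *)
From HB Require Import structures.
From mathcomp Require Import all_boot all_order all_fingroup all_algebra.
From mathcomp Require Import boolp classical_sets functions cardinality fsbigop.
From mathcomp Require Import ring.

Set Implicit Arguments.
Unset Strict Implicit.
Unset Printing Implicit Defensive.

Import GRing.Theory.
Local Open Scope ring_scope.
Local Open Scope quotient_scope.

Section Submodule.
Variables (R : pzRingType) (V : lmodType R) (U : submodClosed V).

Record lsub : Type := Lsub { lsub_val :> V; lsub_valP : lsub_val \in U }.

HB.instance Definition _ := [isSub for lsub_val].
HB.instance Definition _ := [Choice of lsub by <:].
HB.instance Definition _ := [SubChoice_isSubLmodule of lsub by <:].

Lemma lsub_val_linear : linear lsub_val.
Proof. exact: (linearP (\val : lsub -> V)). Qed.

HB.instance Definition _ :=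
  GRing.isLinear.Build R lsub V _ lsub_val lsub_val_linear.

End Submodule.

Section QuotientModule.
Variables (R : pzRingType) (V : lmodType R) (U : submodClosed V).

Definition zmod_of_submod : {pred V} := fun x => x \in U.

Lemma zmod_of_submodP : zmod_closed zmod_of_submod.
Proof. exact: GRing.submod_closedB (GRing.submodClosedP U). Qed.

HB.instance Definition _ :=
  GRing.isZmodClosed.Build V zmod_of_submod zmod_of_submodP.

Definition lquot : Type := {ideal_quot zmod_of_submod}.

HB.instance Definition _ := Choice.on lquot.
HB.instance Definition _ := GRing.Zmodule.on lquot.

Definition lquot_pi (x : V) : lquot := \pi_({ideal_quot zmod_of_submod}) x.
Definition lquot_repr (x : lquot) : V := generic_quotient.repr (x : {ideal_quot zmod_of_submod}).

Lemma lquot_reprK : cancel lquot_repr lquot_pi.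
Proof. exact: (@reprK _ {ideal_quot zmod_of_submod}). Qed.

Lemma lquot_piP x y : reflect (lquot_pi x = lquot_pi y) (x - y \in U).
Proof.
rewrite -[_ \in U]/(x - y \in zmod_of_submod) Quotient.idealrBE.
exact: (@eqP {ideal_quot zmod_of_submod}).
Qed.

Lemma lquot_piD x y : lquot_pi (x + y) = lquot_pi x + lquot_pi y.
Proof. exact: (raddfD (\pi_({ideal_quot zmod_of_submod}))). Qed.

Definition lquot_scale (a : R) (x : lquot) : lquot :=
  lquot_pi (a *: lquot_repr x).

Lemma lquot_scaleE a x : lquot_scale a (lquot_pi x) = lquot_pi (a *: x).
Proof.
apply/lquot_piP; rewrite -scalerBr rpredZ //.
by apply/lquot_piP; rewrite lquot_reprK.
Qed.

Lemma lquot_scaleA a b x :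
  lquot_scale a (lquot_scale b x) = lquot_scale (a * b) x.
Proof. by rewrite -[x]lquot_reprK !lquot_scaleE scalerA. Qed.

Lemma lquot_scale1 : left_id 1 lquot_scale.
Proof. by move=> x; rewrite -[x]lquot_reprK lquot_scaleE scale1r. Qed.

Lemma lquot_scaleDr : right_distributive lquot_scale +%R.
Proof.
move=> a x y; rewrite -[x]lquot_reprK -[y]lquot_reprK.
by rewrite -lquot_piD !lquot_scaleE scalerDr lquot_piD.
Qed.

Lemma lquot_scaleDl x : {morph lquot_scale^~ x : a b / a + b}.
Proof.
by move=> a b; rewrite -[x]lquot_reprK !lquot_scaleE scalerDl lquot_piD.
Qed.

HB.instance Definition _ := GRing.Zmodule_isLmodule.Build R lquot
  lquot_scaleA lquot_scale1 lquot_scaleDr lquot_scaleDl.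

Lemma lquot_pi_linear : linear lquot_pi.
Proof. by move=> a x y; rewrite lquot_piD -lquot_scaleE. Qed.

HB.instance Definition _ :=
  GRing.isLinear.Build R V lquot _ lquot_pi lquot_pi_linear.

End QuotientModule.

Section QuotientMap.
Variables (R : pzRingType) (V W : lmodType R).
Variables (U : submodClosed V) (U' : submodClosed W) (f : {linear V -> W}).
Hypothesis fU : forall x, x \in U -> f x \in U'.

Definition lquot_map of (forall x, x \in U -> f x \in U') :
  lquot U -> lquot U' := fun x => lquot_pi U' (f (lquot_repr x)).

Lemma lquot_mapE x : lquot_map fU (lquot_pi U x) = lquot_pi U' (f x).
Proof.
apply/lquot_piP; rewrite -raddfB fU //.
by apply/lquot_piP; rewrite lquot_reprK.
Qed.

Lemma lquot_map_linear : linear (lquot_map fU).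
Proof.
move=> a x y; rewrite -[x]lquot_reprK -[y]lquot_reprK.
by rewrite -linearP !lquot_mapE !linearP.
Qed.

HB.instance Definition _ :=
  GRing.isLinear.Build R (lquot U) (lquot U') _ (lquot_map fU) lquot_map_linear.

End QuotientMap.

Section Cokernel.
Variables (R : pzRingType) (V W : lmodType R) (f : {linear V -> W}).

Definition lrange : {pred W} := [pred y | `[< exists x, f x = y >]].

Lemma lrange_submod : subsemimod_closed lrange.
Proof.
split; first split; first by apply/asboolP; exists 0; rewrite linear0.
  move=> _ _ /asboolP[x <-] /asboolP[y <-].
  by apply/asboolP; exists (x + y); rewrite linearD.
by move=> a _ /asboolP[x <-]; apply/asboolP; exists (a *: x); rewrite linearZ.
Qed.

HB.instance Definition _ := GRing.isSubmodClosed.Build R W lrange lrange_submod.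

Definition lcoker : lmodType R := lquot lrange.

End Cokernel.

(** The free module on the underlying set of [M]: finitely supported functions
    [M -> R], with the evaluation map [freemod M -> M] and its kernel. *)
Section FreeModule.
Variables (R : pzRingType) (M : lmodType R).

Definition finsupp_fun : {pred M -> R^o} :=
  [pred f | `[< finite_set [set x | f x != 0]%classic >]].

Lemma finsupp_fun_submod : subsemimod_closed finsupp_fun.
Proof.
split; first split.
- apply/asboolP; rewrite (_ : [set x | _]%classic = classical_sets.set0) //.
  by apply/seteqP; split=> x //=; rewrite eqxx.
- move=> f g /asboolP ff /asboolP fg; apply/asboolP.
  apply: (@sub_finite_set _ _
    ([set x | f x != 0] `|` [set x | g x != 0])%classic); last first.
    by rewrite finite_setU.
  move=> x /=; have [fx0|fx0] := eqVneq (f x) 0; last by left.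
  have [gx0|gx0] := eqVneq (g x) 0; last by right.
  by rewrite /GRing.add /= fx0 gx0 addr0 eqxx.
- move=> a f /asboolP ff; apply/asboolP; apply: sub_finite_set ff => x /=.
  by apply: contraNN => /eqP fx0; rewrite -[_ x]/(a * f x) fx0 mulr0.
Qed.

HB.instance Definition _ :=
  GRing.isSubmodClosed.Build R (M -> R^o) finsupp_fun finsupp_fun_submod.

Definition freemod : lmodType R := lsub finsupp_fun.

Definition freemod_eval (f : freemod) : M :=
  \sum_(x \in [set: M]) (val f x : R) *: x.

Lemma freemod_evalE (f : freemod) (A : set M) : finite_set A ->
  ([set x | val f x != 0] `<=` A)%classic ->
  freemod_eval f = \sum_(x \in A) (val f x : R) *: x.
Proof.
move=> finA fA; rewrite /freemod_eval; symmetry.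
apply: fsbig_widen => // x [_ /= nAx]; have [->|fx0] := eqVneq (val f x) 0.
  by rewrite scale0r.
by case: nAx; exact: fA.
Qed.

Lemma freemod_eval_linear : linear freemod_eval.
Proof.
move=> a f g; pose S (h : freemod) := [set x | val h x != 0]%classic.
have finS h : finite_set (S h) by exact/asboolP/(valP h).
pose A := (S (a *: f + g) `|` (S f `|` S g))%classic.
have finA : finite_set A by rewrite !finite_setU; split; [|split]; exact: finS.
rewrite !(@freemod_evalE _ A) //; try by move=> x Sx; do ?[by left | right].
rewrite !(fsbig_finite _ _ finA) /= scaler_sumr -big_split /=.
by apply: eq_bigr => x _; rewrite scalerA -scalerDl.
Qed.

HB.instance Definition _ :=
  GRing.isLinear.Build R freemod M _ freemod_eval freemod_eval_linear.

Definition relmod_pred : {pred freemod} := [pred f | freemod_eval f == 0].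

Lemma relmod_pred_submod : subsemimod_closed relmod_pred.
Proof.
split; first split; rewrite ?inE ?linear0 //.
  move=> f g; rewrite !inE => /eqP f0 /eqP g0.
  by rewrite linearD /= f0 g0 addr0.
by move=> a f; rewrite !inE => /eqP f0; rewrite linearZ /= f0 scaler0.
Qed.

HB.instance Definition _ :=
  GRing.isSubmodClosed.Build R freemod relmod_pred relmod_pred_submod.

Definition relmod : lmodType R := lsub relmod_pred.

End FreeModule.

(** The canonical free resolution
      ... -> freeres M 2 -> freeres M 1 -> freeres M 0 -> M -> 0
    obtained by iterating the free cover [freemod M -> M], and the groups
    Ext^i_R(M, N) = H^i (Hom_R (freeres M, N)). *)
Section Ext.
Variables (R : pzRingType) (M N : lmodType R).

Fixpoint syzygy (i : nat) : lmodType R :=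
  if i is j.+1 then relmod (syzygy j) else M.

Definition freeres (i : nat) : lmodType R := freemod (syzygy i).

Definition freeres_d (i : nat) (x : freeres i.+1) : freeres i :=
  lsub_val (freemod_eval x : relmod (syzygy i)).

Definition cocycle (i : nat) : {pred freeres i -> N} :=
  [pred f | `[< linear f /\ forall x, f (freeres_d x) = 0 >]].

Arguments cocycle : clear implicits.

Lemma cocycle_zmod i : zmod_closed (cocycle i).
Proof.
split=> [|f g /asboolP[lf f0] /asboolP[lg g0]]; apply/asboolP; split=> //.
- by move=> a x y; rewrite /GRing.zero /= scaler0 addr0.
- move=> a x y; rewrite /GRing.opp /GRing.add /=.
  by rewrite lf lg scalerBr opprD addrACA.
- by move=> x; rewrite /GRing.opp /GRing.add /= f0 g0 subrr.
Qed.

HB.instance Definition _ i :=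
  GRing.isZmodClosed.Build (freeres i -> N) (cocycle i) (cocycle_zmod i).

Record cocycles (i : nat) : Type :=
  Cocycle { cocycle_val :> freeres i -> N; cocycle_valP : cocycle_val \in cocycle i }.

HB.instance Definition _ i := [isSub for @cocycle_val i].
HB.instance Definition _ i := [Choice of cocycles i by <:].
HB.instance Definition _ i := [SubChoice_isSubZmodule of cocycles i by <:].

Definition coboundary (i : nat) : {pred cocycles i} :=
  match i with
  | 0 => [pred f | f == 0]
  | j.+1 => [pred f : cocycles j.+1 | `[< exists2 g : freeres j -> N,
              linear g & forall x, f x = g (freeres_d x) >]]
  end.

Arguments coboundary : clear implicits.

Lemma coboundary_zmod i : zmod_closed (coboundary i).
Proof.
case: i => [|j]; split.
- exact/eqP.
- by move=> f g /eqP-> /eqP->; rewrite subrr; exact/eqP.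
- apply/asboolP; exists (fun=> 0) => //.
  by move=> a x y; rewrite scaler0 addr0.
- move=> f g /asboolP[f' lf ff'] /asboolP[g' lg gg']; apply/asboolP.
  exists (fun x => f' x - g' x).
    by move=> a x y; rewrite lf lg scalerBr opprD addrACA.
  by move=> x; rewrite -ff' -gg'.
Qed.

HB.instance Definition _ i :=
  GRing.isZmodClosed.Build (cocycles i) (coboundary i) (coboundary_zmod i).

Definition Ext (i : nat) : zmodType := {ideal_quot (coboundary i)}.

End Ext.

(** With F = Z^n and standard basis (e_u), the tensor power F^{(x) r} has the
    basis e_i = e_(i 0) (x) ... (x) e_(i (r-1)) indexed by the multi-indices
    [i]; [t i] is the coefficient of e_i in [t].  Place permutations act by
    [permidx]. *)
Definition multiidx (n r : nat) : finType := {ffun 'I_r -> 'I_n}.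

Definition permidx (n r : nat) (i : multiidx n r) (s : 'S_r) : multiidx n r :=
  [ffun p => i (s p)].

Lemma permidx1 n r (i : multiidx n r) : permidx i 1%g = i.
Proof. by apply/ffunP=> p; rewrite ffunE perm1. Qed.

Lemma permidxM n r (i : multiidx n r) (s t : 'S_r) :
  permidx (permidx i s) t = permidx i (t * s)%g.
Proof. by apply/ffunP=> p; rewrite !ffunE permM. Qed.

Lemma permidxK n r (s : 'S_r) :
  cancel (fun i : multiidx n r => permidx i s) (fun i => permidx i s^-1%g).
Proof. by move=> i; rewrite permidxM mulVg permidx1. Qed.

Lemma permidxKV n r (s : 'S_r) :
  cancel (fun i : multiidx n r => permidx i s^-1%g) (fun i => permidx i s).
Proof. by move=> i; rewrite permidxM mulgV permidx1. Qed.

Lemma permidx_bij n r (s : 'S_r) :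
  bijective (fun i : multiidx n r => permidx i s).
Proof. by exists (fun i => permidx i s^-1%g); [exact: permidxK|exact: permidxKV]. Qed.

Section SchurAlgebra.
Variables n r : nat.
Local Notation I := (multiidx n r).

(** S_Z(n,r) = End_{Sigma_r}(F^{(x) r}): the integral matrices, in the basis
    (e_i), of the endomorphisms commuting with place permutations. *)
Definition schur_pred : {pred {ffun I * I -> int}} :=
  [pred A : {ffun I * I -> int} | [forall s : 'S_r, forall i : I, forall j : I,
               A (permidx i s, permidx j s) == A (i, j)]].

Lemma schur_predP (A : {ffun I * I -> int}) :
  reflect (forall s i j, A (permidx i s, permidx j s) = A (i, j))
          (A \in schur_pred).
Proof.
apply: (iffP forallP) => [h s i j|h s].
  by have /forallP/(_ i)/forallP/(_ j)/eqP := h s.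
by apply/forallP=> i; apply/forallP=> j; apply/eqP.
Qed.

Lemma schur_zmod : zmod_closed schur_pred.
Proof.
split=> [|A B /schur_predP hA /schur_predP hB]; apply/schur_predP=> s i j.
  by rewrite !ffunE.
by rewrite !ffunE hA hB.
Qed.

HB.instance Definition _ :=
  GRing.isZmodClosed.Build {ffun I * I -> int} schur_pred schur_zmod.

Record schur : Type :=
  Schur { schur_val :> {ffun I * I -> int}; schur_valP : schur_val \in schur_pred }.

HB.instance Definition _ := [isSub for schur_val].
HB.instance Definition _ := [Choice of schur by <:].
HB.instance Definition _ := [SubChoice_isSubZmodule of schur by <:].

Lemma schur_inv (A : schur) s i j : A (permidx i s, permidx j s) = A (i, j).
Proof. by have /schur_predP := schur_valP A. Qed.

Definition schur_one_fun : {ffun I * I -> int} :=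
  [ffun ij => (ij.1 == ij.2)%:R].

Lemma schur_one_subproof : schur_one_fun \in schur_pred.
Proof.
apply/schur_predP=> s i j; rewrite !ffunE /=.
by rewrite (inj_eq (bij_inj (permidx_bij n s))).
Qed.

Definition schur_one : schur := Schur schur_one_subproof.

Definition schur_mul_fun (A B : schur) : {ffun I * I -> int} :=
  [ffun ij => \sum_(k : I) A (ij.1, k) * B (k, ij.2)].

Lemma schur_mul_subproof A B : schur_mul_fun A B \in schur_pred.
Proof.
apply/schur_predP=> s i j; rewrite !ffunE /=.
rewrite (reindex (fun k => permidx k s)) /=; last exact/onW_bij/(permidx_bij n s).
by apply: eq_bigr => k _; rewrite !schur_inv.
Qed.

Definition schur_mul (A B : schur) : schur := Schur (schur_mul_subproof A B).

Lemma schur_mulA : associative schur_mul.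
Proof.
move=> A B C; apply: val_inj; apply/ffunP=> -[i j]; rewrite !ffunE /=.
under eq_bigr do rewrite ffunE /= mulr_sumr.
rewrite exchange_big /=; apply: eq_bigr => k _; rewrite ffunE /= mulr_suml.
by apply: eq_bigr => l _; rewrite mulrA.
Qed.

Lemma schur_mul1 : left_id schur_one schur_mul.
Proof.
move=> A; apply: val_inj; apply/ffunP=> -[i j]; rewrite !ffunE /=.
rewrite (bigD1 i) //= ffunE eqxx mul1r big1 ?addr0 // => k /negbTE ki.
by rewrite ffunE /= eq_sym ki mul0r.
Qed.

Lemma schur_mulr1 : right_id schur_one schur_mul.
Proof.
move=> A; apply: val_inj; apply/ffunP=> -[i j]; rewrite !ffunE /=.
rewrite (bigD1 j) //= ffunE eqxx mulr1 big1 ?addr0 // => k /negbTE ki.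
by rewrite ffunE /= ki mulr0.
Qed.

Lemma schur_mulDl : left_distributive schur_mul +%R.
Proof.
move=> A B C; apply: val_inj; apply/ffunP=> -[i j]; rewrite !ffunE /=.
by rewrite -big_split /=; apply: eq_bigr => k _; rewrite ffunE mulrDl.
Qed.

Lemma schur_mulDr : right_distributive schur_mul +%R.
Proof.
move=> A B C; apply: val_inj; apply/ffunP=> -[i j]; rewrite !ffunE /=.
by rewrite -big_split /=; apply: eq_bigr => k _; rewrite ffunE mulrDr.
Qed.

HB.instance Definition _ := GRing.Zmodule_isPzRing.Build schur
  schur_mulA schur_mul1 schur_mulr1 schur_mulDl schur_mulDr.

Definition tens : Type := {ffun I -> int}.

HB.instance Definition _ := GRing.Zmodule.on tens.

Definition tens_scale (A : schur) (t : tens) : tens :=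
  [ffun i => \sum_(j : I) A (i, j) * t j].

Lemma tens_scaleA A B t :
  tens_scale A (tens_scale B t) = tens_scale (A * B) t.
Proof.
apply/ffunP=> i; rewrite !ffunE.
under eq_bigr do rewrite ffunE mulr_sumr.
rewrite exchange_big /=; apply: eq_bigr => k _; rewrite ffunE /= mulr_suml.
by apply: eq_bigr => l _; rewrite mulrA.
Qed.

Lemma tens_scale1 : left_id 1 tens_scale.
Proof.
move=> t; apply/ffunP=> i; rewrite !ffunE.
rewrite (bigD1 i) //= ffunE eqxx mul1r big1 ?addr0 // => k /negbTE ki.
by rewrite ffunE /= eq_sym ki mul0r.
Qed.

Lemma tens_scaleDr : right_distributive tens_scale +%R.
Proof.
move=> A t u; apply/ffunP=> i; rewrite !ffunE -big_split /=.
by apply: eq_bigr => k _; rewrite ffunE mulrDr.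
Qed.

Lemma tens_scaleDl t : {morph tens_scale^~ t : A B / A + B}.
Proof.
move=> A B; apply/ffunP=> i; rewrite !ffunE -big_split /=.
by apply: eq_bigr => k _; rewrite ffunE mulrDl.
Qed.

HB.instance Definition _ := GRing.Zmodule_isLmodule.Build schur tens
  tens_scaleA tens_scale1 tens_scaleDr tens_scaleDl.

Lemma tensP (t u : tens) : (forall i, t i = u i) -> t = u.
Proof. by move=> tu; apply/ffunP. Qed.

Lemma tensD (t u : tens) i : (t + u) i = t i + u i.
Proof. by rewrite ffunE. Qed.

Lemma tensN (t : tens) i : (- t) i = - t i.
Proof. by rewrite ffunE. Qed.

Lemma tens_scaleE (A : schur) (t : tens) i :
  (A *: t) i = \sum_(j : I) A (i, j) * t j.
Proof. by rewrite ffunE. Qed.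

Lemma tens_scale_perm (A : schur) (t : tens) (s : 'S_r) :
  (forall i, t (permidx i s) = t i) ->
  forall i, (A *: t) (permidx i s) = (A *: t) i.
Proof.
move=> ts i; rewrite !tens_scaleE (reindex (fun k => permidx k s)) /=; last exact/onW_bij/(permidx_bij n s).
by apply: eq_bigr => k _; rewrite schur_inv ts.
Qed.

End SchurAlgebra.

Section Hooks.
Variables n r : nat.
Local Notation I := (multiidx n r).
Local Notation T := (tens n r).

(** D_a F is the group of symmetric tensors in F^{(x) a}; [symtens a] is
    D_a F (x) F^{(x) (r-a)}, the tensors of degree [r] which are symmetric in
    the first [a] places. *)
Definition symtens (a : nat) : {pred T} :=
  [pred t : T | [forall (s : 'S_r | [forall p : 'I_r, (a <= p)%N ==> (s p == p)]),
                   forall i : I, t (permidx i s) == t i]].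

Lemma symtensP a (t : T) :
  reflect (forall s : 'S_r, (forall p : 'I_r, (a <= p)%N -> s p = p) ->
             forall i : I, t (permidx i s) = t i)
          (t \in symtens a).
Proof.
apply: (iffP forallP) => h s.
  move=> hs i; have hs' : [forall p : 'I_r, (a <= p)%N ==> (s p == p)].
    by apply/forallP=> p; apply/implyP=> /hs ->.
  by have /implyP/(_ hs')/forallP/(_ i)/eqP := h s.
apply/implyP=> /forallP hs; apply/forallP=> i; apply/eqP/h => p ap.
by have /implyP/(_ ap)/eqP := hs p.
Qed.

Lemma symtens_submod a : subsemimod_closed (symtens a).
Proof.
split; first split; first by apply/symtensP=> s _ i; rewrite !ffunE.
  move=> t u /symtensP ht /symtensP hu; apply/symtensP=> s hs i.
  by have := ht s hs i; have := hu s hs i; rewrite !ffunE => -> ->.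
move=> A t /symtensP ht; apply/symtensP=> s hs.
by apply: tens_scale_perm => i; apply: ht.
Qed.

HB.instance Definition _ a :=
  GRing.isSubmodClosed.Build (schur n r) T (symtens a) (symtens_submod a).

Lemma symtensS a t : t \in symtens a.+1 -> t \in symtens a.
Proof.
by move=> /symtensP h; apply/symtensP=> s hs; apply: h => p /ltnW; apply: hs.
Qed.

(** x_0 (x) ... (x) x_(r-1) for vectors x_p of F = Z^n *)
Definition puretens (x : {ffun 'I_r -> {ffun 'I_n -> int}}) : T :=
  [ffun i : I => \prod_(p < r) x p (i p)].

(** The kernel of F^{(x) r} -> F^{(x) c} (x) /\^(r-c) F: the subgroup generated
    by the pure tensors having equal factors in two distinct places p, q >= c. *)
Definition repeats (c : nat) (x : {ffun 'I_r -> {ffun 'I_n -> int}}) : bool :=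
  [exists p : 'I_r, exists q : 'I_r, [&& (c <= p)%N, (p < q)%N & x p == x q]].

Definition alttens (c : nat) : {pred T} :=
  [pred t : T | `[< exists2 s : seq (int * {ffun 'I_r -> {ffun 'I_n -> int}}),
      all (fun u => repeats c u.2) s
      & t = \sum_(u <- s) puretens u.2 *~ u.1 >]].

Lemma alttens_zmod c : zmod_closed (alttens c).
Proof.
split=> [|t u /asboolP[s hs ->] /asboolP[s' hs' ->]]; apply/asboolP.
  by exists [::]; rewrite ?big_nil.
exists (s ++ [seq (- v.1, v.2) | v <- s']).
  by rewrite all_cat hs all_map.
rewrite big_cat big_map /= -sumrN; congr (_ + _).
by apply: eq_bigr => v _; rewrite mulrNz.
Qed.

HB.instance Definition _ c :=
  GRing.isZmodClosed.Build T (alttens c) (alttens_zmod c).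

Lemma puretens_alt c x : repeats c x -> puretens x \in alttens c.
Proof.
by move=> hx; apply/asboolP; exists [:: (1, x)]; rewrite ?big_seq1 //= hx.
Qed.


Lemma alttens_swap c (p q : 'I_r) (t : T) : (c <= p)%N -> (p < q)%N ->
  (forall i, t (permidx i (tperm p q)) = t i) -> t \in alttens c.
Proof.
move=> cp pq ts; pose s := tperm p q.
have qp : q != p by apply: contraTneq pq => ->; rewrite ltnn.
pose bs (u : 'I_n) : {ffun 'I_n -> int} := [ffun v => (v == u)%:R].
pose e (i : I) : T := [ffun j => (j == i)%:R].
have pureE x (j : I) : puretens x j = x p (j p) * x q (j q) *
    \prod_(m | (m != p) && (m != q)) x m (j m).
  by rewrite ffunE (bigD1 p) //= (bigD1 q) //= mulrA.
have eE i : e i = puretens [ffun m => bs (i m)].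
  apply/ffunP=> j; rewrite !ffunE; have [->|ji] := eqVneq j i.
    by rewrite big1 // => m _; rewrite !ffunE eqxx.
  have [m jm] : exists m, j m != i m.
    by apply/existsP; apply: contraNT ji; rewrite negb_exists => /forallP ji;
       apply/eqP/ffunP=> m; apply/eqP; rewrite -[_ == _]negbK ji.
  by rewrite (bigD1 m) //= !ffunE (negbTE jm) mul0r.
pose x2 (i : I) (w : {ffun 'I_n -> int}) : {ffun 'I_r -> {ffun 'I_n -> int}} :=
  [ffun m => if (m == p) || (m == q) then w else bs (i m)].
have x2alt (i : I) w : puretens (x2 i w) \in alttens c.
  apply: puretens_alt; apply/existsP; exists p; apply/existsP; exists q.
  by rewrite cp pq !ffunE !eqxx orbT /=.
have e_alt (i : I) : i p = i q -> e i \in alttens c.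
  move=> ipq; rewrite eE (_ : finfun _ = x2 i (bs (i p))) //.
  apply/ffunP=> m; rewrite !ffunE; case: eqVneq => [->|_] //=.
  by case: eqVneq => [->|_] //=; rewrite ipq.
have ee_alt (i : I) : e i + e (permidx i s) \in alttens c.
  have -> : e i + e (permidx i s) = puretens (x2 i (bs (i p) + bs (i q)))
      - puretens (x2 i (bs (i p))) - puretens (x2 i (bs (i q))).
    apply: tensP => j; rewrite !tensD !tensN !eE !pureE.
    pose P := \prod_(m | (m != p) && (m != q)) bs (i m) (j m).
    have PE x : (forall m, m != p -> m != q -> x m = bs (i m)) ->
        \prod_(m | (m != p) && (m != q)) (x m : {ffun _}) (j m) = P.
      by move=> h; apply: eq_bigr => m /andP[mp mq]; rewrite h.
    rewrite !PE; first last.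
    - by move=> m _ _; rewrite ffunE.
    - by move=> m mp mq; rewrite !ffunE tpermD // eq_sym.
    - by move=> m mp mq; rewrite ffunE (negbTE mp) (negbTE mq).
    - by move=> m mp mq; rewrite ffunE (negbTE mp) (negbTE mq).
    - by move=> m mp mq; rewrite ffunE (negbTE mp) (negbTE mq).
    rewrite !ffunE !eqxx (negbTE qp) /= tpermL tpermR !ffunE.
    by ring.
  by rewrite !rpredB.
have tE : t = \sum_i e i *~ t i.
  apply/ffunP=> j; rewrite sum_ffunE (bigD1 j) //= big1 => [|i ij].
    by rewrite ffunMzE ffunE eqxx addr0 mulrzz mul1r.
  by rewrite ffunMzE ffunE eq_sym (negbTE ij) mul0rz.
rewrite tE (bigID (fun i : I => i p == i q)) /= rpredD //.
  by apply: rpred_sum => i /eqP ipq; rewrite rpredMz ?e_alt.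
rewrite (bigID (fun i : I => (i p < i q)%N)) /=.
rewrite [X in _ + X](reindex (fun i => permidx i s)) /=; last first.
  exact/onW_bij/(permidx_bij n s).
have -> : \sum_(i : I | (permidx i s p != permidx i s q) &&
      ~~ (permidx i s p < permidx i s q)%N) e (permidx i s) *~ t (permidx i s)
    = \sum_(i : I | (i p != i q) && (i p < i q)%N) e (permidx i s) *~ t i.
  apply: eq_big => [i|i _]; last by rewrite ts.
  rewrite !ffunE tpermL tpermR -leqNgt leq_eqVlt eq_sym.
  by rewrite -[(_ == _ :> nat)]/(i p == i q); case: eqVneq.
rewrite -big_split /=; apply: rpred_sum => i _.
by rewrite -mulrzDl rpredMz.
Qed.

Lemma puretens_perm (p q : 'I_r) (x : {ffun 'I_r -> {ffun 'I_n -> int}}) :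
  x p = x q -> forall i : I, puretens x (permidx i (tperm p q)) = puretens x i.
Proof.
move=> xpq i; rewrite !ffunE.
rewrite [RHS](reindex_inj (@perm_inj _ (tperm p q))) /=.
by apply: eq_bigr => m _; rewrite ffunE; case: tpermP => // ->; rewrite xpq.
Qed.

Lemma alttens_submod c : subsemimod_closed (alttens c).
Proof.
split; first by exact: GRing.zmod_closedD (alttens_zmod c).
move=> A _ /asboolP[s hs ->]; rewrite scaler_sumr big_seq rpred_sum // => u us.
rewrite (raddfMz ( *:%R A)) /= rpredMz //.
have /existsP[p /existsP[q /and3P[cp pq /eqP xpq]]] := allP hs u us.
apply: (alttens_swap cp pq); apply: tens_scale_perm.
exact: (puretens_perm xpq).
Qed.

HB.instance Definition _ c :=
  GRing.isSubmodClosed.Build (schur n r) T (alttens c) (alttens_submod c).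

Lemma alttensS c t : t \in alttens c.+1 -> t \in alttens c.
Proof.
move=> /asboolP[s hs ->]; apply/asboolP; exists s => //.
apply: sub_all hs => u /existsP[p /existsP[q /and3P[cp pq xpq]]].
by apply/existsP; exists p; apply/existsP; exists q; rewrite (ltnW cp) pq.
Qed.

(** D_a F (x) F^{(x) (c-a)} (x) /\^(r-c) F for [a <= c <= r].  It is the image
    of [symtens a] in F^{(x) c} (x) /\^(r-c) F: since /\^(r-c) F is free,
    tensoring the inclusion of D_a F in F^{(x) a} with it is injective. *)
Definition symalt_rel (a c : nat) : {pred lsub (symtens a)} :=
  [pred t | lsub_val t \in alttens c].

Arguments symalt_rel : clear implicits.

Lemma symalt_rel_submod a c : subsemimod_closed (symalt_rel a c).
Proof.
have [[h0 hD] hZ] := alttens_submod c.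
have E t : (t \in symalt_rel a c) = (lsub_val t \in alttens c) by [].
split; first split; first by rewrite E linear0.
  by move=> t u; rewrite !E linearD; exact: hD.
by move=> A t; rewrite !E linearZ; exact: hZ.
Qed.

HB.instance Definition _ a c := GRing.isSubmodClosed.Build (schur n r)
  (lsub (symtens a)) (symalt_rel a c) (symalt_rel_submod a c).

Definition symalt (a c : nat) : lmodType (schur n r) := lquot (symalt_rel a c).

(** The inclusion of D_(a+1) F in D_a F (x) D_1 F as tensors symmetric in all
    places is the comultiplication: x^(a+1) |-> x^(a) (x) x on divided powers. *)
Definition symtens_incl (a : nat) (t : lsub (symtens a.+1)) :
  lsub (symtens a) := Lsub (symtensS (lsub_valP t)).

Lemma symtens_incl_linear a : linear (@symtens_incl a).
Proof. by move=> A t u; apply: val_inj; rewrite linearP. Qed.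

HB.instance Definition _ a := GRing.isLinear.Build (schur n r)
  (lsub (symtens a.+1)) (lsub (symtens a)) _ (@symtens_incl a)
  (@symtens_incl_linear a).

Lemma comult_subproof a t :
  t \in symalt_rel a.+1 a.+1 -> symtens_incl t \in symalt_rel a a.+1.
Proof. by []. Qed.

(** D_(a+1) F (x) /\^(r-a-1) F -> D_a F (x) D_1 F (x) /\^(r-a-1) F *)
Definition comult (a : nat) : {linear symalt a.+1 a.+1 -> symalt a a.+1} :=
  lquot_map (@comult_subproof a).

Lemma mult_subproof a t : t \in symalt_rel a a.+1 -> idfun t \in symalt_rel a a.
Proof. exact: alttensS. Qed.

(** D_a F (x) D_1 F (x) /\^(r-a-1) F -> D_a F (x) /\^(r-a) F, induced by the
    multiplication F (x) /\^(r-a-1) F -> /\^(r-a) F, which is the identity on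
    representatives in tensor space. *)
Definition mult (a : nat) : {linear symalt a a.+1 -> symalt a a} :=
  lquot_map (@mult_subproof a).

(** The Weyl module Delta(a, 1^(r-a)) of degree [r], for [a <= r]; when [a = r]
    it is D_r F. *)
Definition hookWeyl (a : nat) : lmodType (schur n r) :=
  if (a < r)%N then lcoker (mult a \o comult a) else lsub (symtens a).

End Hooks.

(* Main.v *)
Require Import Defs.
From HB Require Import structures.
From mathcomp Require Import all_boot all_order all_fingroup all_algebra.
From mathcomp Require Import boolp classical_sets functions cardinality fsbigop.
From mathcomp Require Import zify ring.

Set Implicit Arguments.
Unset Strict Implicit.
Unset Printing Implicit Defensive.

Import GRing.Theory.
Local Open Scope ring_scope.

(** Write P for D_a F (x) F^{(x) b}, K for the kernel of P -> Delta(h), and N for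
    Delta(h(k)).  As P is projective, generated by a vector of weight (a,1^b),
    Ext^1(Delta(h), N) is Hom(K, N) modulo the restrictions of Hom(P, N).
    Alternating the last b-k+1 places embeds N in tensor space, with image cut
    out by linear equations; so N is torsion-free, and an element of N all of
    whose coefficients are divisible by d is divisible by d in N.

    Let H : K -> N.  The sum of H(t - sgn(s) s t) over the permutations s of the
    last b places is defined for every t in P and equals b! H on the tensors
    whose image in D_a F (x) /\^b F is zero.  It equals b! H on all of K, since
    the sum of all transpositions of places acts on Delta(h(1)) and on N by
    different scalars.  So b! H is given by a vector X of weight (a,1^b) in N.
    As k >= 2, a word contributing to X has two letters in its row, and the
    relation given by their transposition doubles its coefficient: X is
    divisible by b!/2, and 2H extends to P.  Modulo 2 the resulting coefficients
    do not change when two letters are exchanged, so they are all even, and then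
    H extends, or all odd.  Evaluating at the generator of D_{a+1} F (x) F^{(x) (b-1)}
    shows that they can be odd only if a+b+k is odd, in which case
    half of any vector with odd coefficients does define a map K -> N. *)

(** * Permutations of places *)

Section Perms.
Variable r : nat.
Implicit Types (p q x : 'I_r) (s g h : 'S_r) (c : nat).

(** Induction on the number of moved points: if [s] moves [p], composing with the transposition of
    [p] and [s p] makes [s p] fixed and moves no new point. *)
Lemma perm_class_ind (K : eqType) (cls : 'I_r -> K) (P : 'S_r -> Prop) :
  P 1%g ->
  (forall p q s, cls p = cls q -> p != q -> P s -> P (tperm p q * s)%g) ->
  forall s, (forall p, cls (s p) = cls p) -> P s.
Proof.
move=> P1 PM s; have [N] := ubnP #|[set p | s p != p]|.
elim: N s => // N IH s sN sc.
have [s0|[p]] := set_0Vmem [set p | s p != p].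
  suff -> : s = 1%g by [].
  apply/permP=> p; rewrite perm1; apply/eqP.
  by have := finset.in_set0 p; rewrite -s0 inE => /negbFE.
rewrite inE => sp; set q := s p in sp.
have -> : s = (tperm p q * (tperm p q * s))%g by rewrite mulgA tperm2 mul1g.
apply: PM; rewrite 1?eq_sym ?sc //; apply: IH; last first.
  by move=> x; rewrite permM; case: tpermP => [->|->|_ _]; rewrite !sc // /q ?sc.
rewrite -ltnS; apply: leq_trans sN; rewrite ltnS; apply: proper_card.
apply/properP; split.
  apply/fintype.subsetP=> x; rewrite !inE permM; case: tpermP => [-> //|->|//].
  by rewrite -/q eqxx.
exists q; rewrite ?inE.
  by apply: contraNneq sp; rewrite {2}/q => /perm_inj->.
by rewrite permM tpermR -/q eqxx.
Qed.

Lemma perm_mono_id s : (forall p q, (p < q)%N -> (s p < s q)%N) -> s = 1%g.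
Proof.
have key (t : 'S_r) : (forall p q, (p < q)%N -> (t p < t q)%N) -> forall p, (p <= t p)%N.
  move=> tm [m]; elim: m => // m IH mr.
  exact: leq_ltn_trans (IH (ltnW mr)) (tm (Ordinal (ltnW mr)) (Ordinal mr) (ltnSn m)).
move=> sm; apply/permP=> p; rewrite perm1; apply/ord_inj/eqP.
rewrite eqn_leq (key s sm) andbT.
rewrite -{2}(permK s p); apply: key => x y; rewrite -{1}(permKV s x) -{1}(permKV s y).
by apply: contraTT; rewrite -!leqNgt leq_eqVlt => /orP[/eqP/val_inj-> //|/sm/ltnW].
Qed.

Definition fixlt c s := [forall p : 'I_r, (p < c)%N ==> (s p == p)].
Definition fixge c s := [forall p : 'I_r, (c <= p)%N ==> (s p == p)].

Lemma fixltP c s : reflect (forall p, (p < c)%N -> s p = p) (fixlt c s).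
Proof.
apply: (iffP forallP) => h p; first by move=> pc; apply/eqP/(implyP (h p)).
by apply/implyP=> /h ->.
Qed.

Lemma fixgeP c s : reflect (forall p, (c <= p)%N -> s p = p) (fixge c s).
Proof.
apply: (iffP forallP) => h p; first by move=> pc; apply/eqP/(implyP (h p)).
by apply/implyP=> /h ->.
Qed.

Lemma fixlt1 c : fixlt c 1%g.
Proof. by apply/fixltP=> p; rewrite perm1. Qed.

Lemma fixltM c s g : fixlt c s -> fixlt c g -> fixlt c (s * g)%g.
Proof. by move=> /fixltP hs /fixltP hg; apply/fixltP=> p pc; rewrite permM hs ?hg. Qed.

Lemma fixltV c s : fixlt c s^-1%g = fixlt c s.
Proof.
suff h t : fixlt c t -> fixlt c t^-1%g.
  by apply/idP/idP => [/h|/h]; rewrite ?invgK.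
by move=> /fixltP ht; apply/fixltP=> p pc; rewrite -{1}(ht _ pc) permK.
Qed.

Lemma fixltMr c s g : fixlt c g -> fixlt c (s * g)%g = fixlt c s.
Proof.
move=> hg; apply/idP/idP => [h|h]; last exact: fixltM.
by rewrite -(mulgK g s) fixltM ?fixltV.
Qed.

Lemma fixltMl c s g : fixlt c g -> fixlt c (g * s)%g = fixlt c s.
Proof.
move=> hg; apply/idP/idP => [h|h]; last exact: fixltM.
by rewrite -(mulKg g s) fixltM ?fixltV.
Qed.

Lemma fixlt_tperm c p q : (c <= p)%N -> (c <= q)%N -> fixlt c (tperm p q).
Proof.
move=> cp cq; apply/fixltP=> x xc; rewrite tpermD //.
  by apply: contraTneq xc => <-; rewrite -leqNgt.
by apply: contraTneq xc => <-; rewrite -leqNgt.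
Qed.

Lemma fixge_tperm c p q : (p < c)%N -> (q < c)%N -> fixge c (tperm p q).
Proof.
move=> cp cq; apply/fixgeP=> x xc; rewrite tpermD //.
  by apply: contraTneq xc => <-; rewrite -ltnNge.
by apply: contraTneq xc => <-; rewrite -ltnNge.
Qed.

Lemma fixlt_ge c s p : fixlt c s -> (c <= p)%N -> (c <= s p)%N.
Proof.
move=> /fixltP hs; apply: contraTT; rewrite -!ltnNge => spc.
by have /perm_inj := hs _ spc => <-.
Qed.

Lemma fixge_lt c s p : fixge c s -> (p < c)%N -> (s p < c)%N.
Proof.
move=> /fixgeP hs; apply: contraTT; rewrite -!leqNgt => spc.
by have /perm_inj := hs _ spc => <-.
Qed.

Lemma fixlt_ind c (P : 'S_r -> Prop) : P 1%g ->
  (forall p q s, (c <= p)%N -> (c <= q)%N -> p != q -> P s -> P (tperm p q * s)%g) ->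
  forall s, fixlt c s -> P s.
Proof.
move=> P1 PM s hs.
apply: (perm_class_ind (cls := fun p => if (p < c)%N then Some p else None)) => //.
  move=> p q g; case: ltnP => pc; case: ltnP => qc //; last by move=> _; apply: PM.
  by case=> ->; rewrite eqxx.
move=> p; case: (ltnP p c) => pc; first by rewrite (fixltP _ _ hs) // pc.
by rewrite ltnNge fixlt_ge.
Qed.

End Perms.

(** * Alternation of tensors *)

Section Alternation.
Variables n r : nat.
Local Notation I := (multiidx n r).
Local Notation T := (tens n r).
Implicit Types (i j : I) (t u v x f : T) (p q : 'I_r) (g h s : 'S_r) (c : nat).

Definition sorted_from c i :=
  [forall p : 'I_r, forall q : 'I_r, (c <= p)%N ==> (p < q)%N ==> (i p < i q)%N].

Lemma sorted_fromP c i :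
  reflect (forall p q, (c <= p)%N -> (p < q)%N -> (i p < i q)%N) (sorted_from c i).
Proof.
apply: (iffP forallP) => h p.
  by move=> q cp pq; have /forallP/(_ q) := h p; rewrite cp pq.
by apply/forallP=> q; apply/implyP=> cp; apply/implyP; apply: h.
Qed.

Lemma sorted_from_inj c i p q :
  sorted_from c i -> (c <= p)%N -> (c <= q)%N -> i p = i q -> p = q.
Proof.
move=> /sorted_fromP si cp cq ipq; apply/val_inj/eqP => /=.
case: ltngtP => // pq; [have := si _ _ cp pq|have := si _ _ cq pq];
  by rewrite ipq ltnn.
Qed.

Lemma sorted_from_unique c i g :
  sorted_from c i -> fixlt c g -> sorted_from c (permidx i g) -> g = 1%g.
Proof.
move=> /sorted_fromP si hg /sorted_fromP sg; apply: perm_mono_id => p q pq.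
have [cp|pc] := leqP c p.
  have cq : (c <= q)%N := leq_trans cp (ltnW pq).
  have := sg _ _ cp pq; rewrite !ffunE; apply: contraTT; rewrite -!leqNgt leq_eqVlt.
  by case/orP=> [/eqP/val_inj-> //|/(si _ _ (fixlt_ge hg cq))/ltnW].
rewrite (fixltP _ _ hg p) //; have [cq|qc] := leqP c q.
  exact: leq_trans pc (fixlt_ge hg cq).
by rewrite (fixltP _ _ hg q).
Qed.

Lemma sorting_perm c i :
  (forall p q, (c <= p)%N -> (c <= q)%N -> i p = i q -> p = q) ->
  exists2 g, fixlt c g & sorted_from c (permidx i g).
Proof.
move=> inji; pose F g := (\sum_(p < r) p * i (g p))%N.
(* Rearrangement inequality: removing an inversion increases [F], so a maximiser is sorted. *)
case: (@arg_maxnP _ 1%g (fixlt c) F (fixlt1 r c)) => g hg gmax; exists g => //.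
apply/sorted_fromP=> p q cp pq; rewrite !ffunE ltnNge; apply/negP=> igpq.
have cq : (c <= q)%N := leq_trans cp (ltnW pq).
have qp : q != p by apply: contraTneq pq => ->; rewrite ltnn.
have {igpq} igpq : (i (g q) < i (g p))%N.
  rewrite ltn_neqAle igpq andbT; apply: contra qp => /eqP/val_inj e.
  by have /perm_inj/eqP := inji _ _ (fixlt_ge hg cq) (fixlt_ge hg cp) e.
have := gmax (tperm p q * g)%g; rewrite fixltM ?fixlt_tperm // => /(_ isT).
have FE h : F h = (p * i (h p) + (q * i (h q) +
    \sum_(x < r | (x != p) && (x != q)) x * i (h x)))%N.
  by rewrite /F (bigD1 p) //= (bigD1 q).
rewrite /= (FE g) (FE (tperm p q * g)%g) !permM tpermL tpermR.
have -> : (\sum_(x < r | (x != p) && (x != q)) x * i ((tperm p q * g)%g x) =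
    \sum_(x < r | (x != p) && (x != q)) x * i (g x))%N.
  by apply: eq_bigr => x /andP[xp xq]; rewrite permM tpermD // eq_sym.
set Z := (X in (_ + (_ + X))%N); nia.
Qed.

(** Induced by the comultiplication that embeds /\^(r-c) F in tensor space. It allows exterior
    powers to be handled as antisymmetric tensors. *)
Definition alt c t : T :=
  [ffun i => \sum_(g : 'S_r | fixlt c g) (-1) ^+ g * t (permidx i g)].

Lemma altE c t i :
  alt c t i = \sum_(g : 'S_r | fixlt c g) (-1) ^+ g * t (permidx i g).
Proof. by rewrite ffunE. Qed.

Lemma alt_linear c : linear (alt c).
Proof.
move=> A t u; apply: tensP => i; rewrite tensD tens_scaleE !altE.
under eq_bigr do rewrite tensD mulrDr.
rewrite big_split /=; congr (_ + _); under [RHS]eq_bigr do rewrite altE mulr_sumr.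
rewrite exchange_big /=; apply: eq_bigr => g _; rewrite tens_scaleE mulr_sumr.
rewrite (reindex (fun k => permidx k g)) /=; last exact/onW_bij/(permidx_bij n g).
by apply: eq_bigr => j _; rewrite schur_inv mulrCA.
Qed.

HB.instance Definition _ c := GRing.isLinear.Build (schur n r) T T _ (alt c) (alt_linear c).

Definition antisym c t := forall g i, fixlt c g -> t (permidx i g) = (-1) ^+ g * t i.

Lemma signM1 (e : bool) (y : int) : (-1) ^+ e * ((-1) ^+ e * y) = y.
Proof. by rewrite mulrA -signr_addb addbb expr0 mul1r. Qed.

Lemma alt_antisym c t : antisym c (alt c t).
Proof.
move=> h i hh; rewrite !altE (reindex_inj (mulIg h^-1)%g) /= mulr_sumr.
apply: eq_big => [g|g _]; first by rewrite fixltMr ?fixltV.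
by rewrite permidxM mulgKV odd_permM odd_permV signr_addb -mulrA mulrCA.
Qed.

(** Composing with [tperm p q] reverses all signs, so each coefficient is its own negative. *)
Lemma alt_sym0 c p q t : (c <= p)%N -> (c <= q)%N -> p != q ->
  (forall i, t (permidx i (tperm p q)) = t i) -> alt c t = 0.
Proof.
move=> cp cq pq tpq; apply: tensP => i; rewrite [RHS]ffunE.
suff : alt c t i = - alt c t i by lia.
rewrite {1}altE (reindex_inj (mulgI (tperm p q))) /= altE -sumrN.
apply: eq_big => [g|g _]; first by rewrite fixltMl ?fixlt_tperm.
by rewrite odd_mul_tperm pq -permidxM tpq addTb signrN mulNr.
Qed.

Lemma antisym_tperm c t p q i : antisym c t -> (c <= p)%N -> (c <= q)%N -> p != q ->
  t (permidx i (tperm p q)) = - t i.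
Proof.
by move=> ta cp cq pq; rewrite ta ?fixlt_tperm // odd_tperm pq expr1 mulN1r.
Qed.

Lemma antisym_repeat c t p q i : antisym c t -> (c <= p)%N -> (c <= q)%N -> p != q ->
  i p = i q -> t i = 0.
Proof.
move=> ta cp cq pq ipq; have := antisym_tperm i ta cp cq pq.
suff -> : permidx i (tperm p q) = i by lia.
by apply/ffunP=> x; rewrite ffunE; case: tpermP => // ->.
Qed.

Lemma alt_alttens c t : t \in alttens c -> alt c t = 0.
Proof.
move=> /asboolP[s hs ->]; rewrite raddf_sum big_seq big1 // => u us.
rewrite (raddfMz (alt c)).
have /existsP[p /existsP[q /and3P[cp pq /eqP xpq]]] := allP hs u us.
rewrite /= (@alt_sym0 _ p q) ?mul0rz //; first exact: leq_trans cp (ltnW pq).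
  by apply: contraTneq pq => ->; rewrite ltnn.
exact: puretens_perm.
Qed.

(** Coset decomposition by the image [q] of the place [c]: such a [g] is a permutation fixing all
    places up to [c], followed by the transposition of [c] and [q], which costs a sign unless
    [q = c]. *)
Lemma alt_rec c (cr : (c < r)%N) t i :
  alt c t i = alt c.+1 t i -
    \sum_(q : 'I_r | (c < q)%N) alt c.+1 t (permidx i (tperm (Ordinal cr) q)).
Proof.
set pc := Ordinal cr.
have E (q : 'I_r) : (c <= q)%N ->
    \sum_(g : 'S_r | fixlt c g && (g pc == q)) (-1) ^+ g * t (permidx i g) =
    (-1) ^+ (pc != q) * alt c.+1 t (permidx i (tperm pc q)).
  move=> cq; rewrite altE (reindex_inj (mulIg (tperm pc q))) /= mulr_sumr.
  apply: eq_big => [g|g _]; last first.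
    by rewrite permidxM odd_permM odd_tperm signr_addb -mulrA mulrCA.
  rewrite fixltMr ?fixlt_tperm // permM.
  apply/andP/fixltP => [[/fixltP hg /eqP gq] p|hg].
    rewrite ltnS leq_eqVlt => /orP[/eqP pE|/hg //].
    have -> : p = pc by apply: val_inj.
    by apply: (can_inj (tpermK pc q)); rewrite gq tpermL.
  split; first by apply/fixltP=> p pc'; apply: hg; exact: ltnW.
  by rewrite hg ?tpermL.
rewrite [LHS]altE.
rewrite (partition_big (fun g : 'S_r => g pc) (fun q : 'I_r => (c <= q)%N)) /=; last first.
  by move=> g hg; rewrite fixlt_ge.
rewrite (bigD1 pc) //= E // eqxx expr0 mul1r tperm1 permidx1; congr (_ + _).
rewrite -sumrN; apply: eq_big => [q|q /andP[cq qp]].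
  by rewrite ltn_neqAle andbC eq_sym.
by rewrite E // eq_sym qp expr1 mulN1r.
Qed.

Lemma symtens_alt a c t : (a <= c)%N -> t \in symtens a -> alt c t \in symtens a.
Proof.
move=> ac /symtensP ht; apply/symtensP=> s hs i; rewrite !altE.
apply: eq_bigr => g /fixltP hg; congr (_ * _); rewrite permidxM.
have -> : (g * s = s * g)%g.
  apply/permP=> p; rewrite !permM; have [pa|ap] := ltnP p a.
    rewrite hg ?(leq_trans pa) // hg // (leq_trans _ ac) // fixge_lt //.
    exact/fixgeP.
  rewrite [s p]hs //; have [pc|cp] := ltnP p c; first by rewrite hg // hs.
  by rewrite hs // (leq_trans ac) // fixlt_ge //; exact/fixltP.
by rewrite -permidxM ht.
Qed.

End Alternation.

(** * Generators of the kernel of alternation *)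

Section AltKernel.
Variables n r : nat.
Local Notation I := (multiidx n r).
Local Notation T := (tens n r).
Implicit Types (i j : I) (t u v x f : T) (p q : 'I_r) (g h s : 'S_r) (c : nat).

Lemma permidx_tperm_id i p q : i p = i q -> permidx i (tperm p q) = i.
Proof. by move=> ipq; apply/ffunP=> x; rewrite ffunE; case: tpermP => // ->. Qed.

Definition sact g u : T := [ffun i => (-1) ^+ g * u (permidx i g)].

Lemma sactE g u i : sact g u i = (-1) ^+ g * u (permidx i g).
Proof. by rewrite ffunE. Qed.

Lemma fixge_fixlt_comm c s g : fixge c s -> fixlt c g -> (g * s = s * g)%g.
Proof.
move=> hs hg; apply/permP=> p; rewrite !permM; have [pc|cp] := ltnP p c.
  by rewrite (fixltP _ _ hg p) // (fixltP _ _ hg) // fixge_lt.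
by rewrite [s p](fixgeP _ _ hs) // (fixgeP _ _ hs) // fixlt_ge.
Qed.

Lemma symtens_fixge c t s i : t \in symtens c -> fixge c s -> t (permidx i s) = t i.
Proof. by move=> /symtensP ht /fixgeP hs; exact: ht. Qed.

Lemma fixge_symtens c t :
  (forall s i, fixge c s -> t (permidx i s) = t i) -> t \in symtens c.
Proof. by move=> ht; apply/symtensP=> s hs i; apply: ht; exact/fixgeP. Qed.

Lemma symtens_sact c g u : fixlt c g -> u \in symtens c -> sact g u \in symtens c.
Proof.
move=> hg hu; apply: fixge_symtens => s i hs; rewrite !sactE permidxM.
by rewrite (fixge_fixlt_comm hs hg) -permidxM (symtens_fixge _ hu).
Qed.

Section Induction.
Variables (c : nat) (Q : T -> Prop).
Hypothesis Q0 : Q 0.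
Hypothesis QB : forall u v, Q u -> Q v -> Q (u - v).
Hypothesis Qsym : forall u p q, u \in symtens c -> (c <= p)%N -> (c <= q)%N ->
  p != q -> (forall i, u (permidx i (tperm p q)) = u i) -> Q u.

Let QD u v : Q u -> Q v -> Q (u + v).
Proof. by move=> hu hv; rewrite -[v]opprK -[- v]add0r; apply: QB => //; apply: QB. Qed.

(** Telescoping along a factorisation of [g] into transpositions: a tensor minus its signed
    transpose is symmetric in the two places concerned. *)
Lemma sub_sact_ind g u : fixlt c g -> u \in symtens c -> Q (u - sact g u).
Proof.
move=> hg; move: g hg u; apply: fixlt_ind => [u _|p q s cp cq pq IH u hu].
  suff -> : sact 1%g u = u by rewrite subrr.
  by apply: tensP => i; rewrite sactE odd_perm1 mul1r permidx1.
pose v := sact (tperm p q) u.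
have hv : v \in symtens c by rewrite symtens_sact ?fixlt_tperm.
have vE i : v i = - u (permidx i (tperm p q)).
  by rewrite sactE odd_tperm pq expr1 mulN1r.
have -> : u - sact (tperm p q * s)%g u = (u - v) + (v - sact s v).
  rewrite addrA subrK; congr (_ - _); apply: tensP => i.
  rewrite [sact _ u i]sactE [sact s v i]sactE vE odd_mul_tperm pq addTb signrN.
  by rewrite -permidxM mulNr mulrN.
apply: QD; last exact: IH.
apply: (Qsym _ cp cq pq); first by rewrite rpredB.
by move=> i; rewrite !tensD !tensN !vE permidxM tperm2 permidx1 !opprK addrC.
Qed.

(** Words with a repeated letter from place [c] on contribute tensors symmetric in two places. The
    other words are sorted at the cost of differences covered by [sub_sact_ind]; what then
    accumulates at a sorted word is the coefficient of [alt c x], which is zero. The predicate [Q]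
    is abstract because it serves both for membership in [alttens c] and for divisibility by 2. *)
Lemma alt_kernel_ind x : x \in symtens c -> alt c x = 0 -> Q x.
Proof.
move=> hx x0.
pose rep (i : I) (pq : 'I_r * 'I_r) :=
  [&& (c <= pq.1)%N, (c <= pq.2)%N, pq.1 != pq.2 & i pq.1 == i pq.2].
(* [pick] assigns each word with a repeated letter to one pair of places only, so the supports of
   the [xr pq] are disjoint. *)
pose xr (pq : 'I_r * 'I_r) : T :=
  [ffun i => if [pick z | rep i z] == Some pq then x i else 0].
pose xg g : T := [ffun i => if sorted_from c (permidx i g) then x i else 0].
have tail i s p : fixge c s -> (c <= p)%N -> permidx i s p = i p.
  by move=> /fixgeP hs cp; rewrite ffunE hs.
have Qr pq : Q (xr pq).
  case: pq => p q; have [cp|pc] := leqP c p; last first.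
    suff -> : xr (p, q) = 0 by [].
    apply: tensP => i; rewrite !ffunE; case: pickP => // z rz.
    by case: eqP => // -[] ez; move: rz; rewrite ez /rep /= leqNgt pc.
  have [cq|qc] := leqP c q; last first.
    suff -> : xr (p, q) = 0 by [].
    apply: tensP => i; rewrite !ffunE; case: pickP => // z rz.
    by case: eqP => // -[] ez; move: rz; rewrite ez /rep /= [(c <= q)%N]leqNgt qc !andbF.
  have [pq|pq] := eqVneq p q.
    suff -> : xr (p, q) = 0 by [].
    apply: tensP => i; rewrite !ffunE; case: pickP => // z rz.
    by case: eqP => // -[] ez; move: rz; rewrite ez /rep /= pq eqxx !andbF.
  apply: (Qsym _ cp cq pq).
    apply: fixge_symtens => s i hs; rewrite !ffunE (symtens_fixge _ hx) //.
    rewrite (eq_pick (Q := rep i)) // => -[p' q']; rewrite /rep /=.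
    by case: leqP => //= cp'; case: leqP => //= cq'; rewrite !tail.
  move=> i; have [ipq|ipq] := eqVneq (i p) (i q); first by rewrite permidx_tperm_id.
  have N j : j p != j q -> xr (p, q) j = 0.
    move=> jpq; rewrite ffunE; case: pickP => // z rz.
    by case: eqP => // -[] ez; move: rz; rewrite ez /rep /= (negbTE jpq) !andbF.
  by rewrite !N // !ffunE tpermL tpermR eq_sym.
have Qg g : fixlt c g -> Q (xg g - sact g^-1%g (xg g)).
  move=> hg; apply: sub_sact_ind; rewrite ?fixltV //.
  apply: fixge_symtens => s i hs; rewrite !ffunE (symtens_fixge _ hx) //.
  rewrite permidxM (fixge_fixlt_comm hs hg) -permidxM.
  suff -> : sorted_from c (permidx (permidx i g) s) = sorted_from c (permidx i g) by [].
  apply/sorted_fromP/sorted_fromP => si p q cp pq; have := si _ _ cp pq;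
    by rewrite !(tail (permidx i g)) // (leq_trans cp) // ltnW.
have -> : x = \sum_pq xr pq + \sum_(g | fixlt c g) (xg g - sact g^-1%g (xg g)).
  rewrite sumrB [X in _ - X](_ : _ = 0) ?subr0.
    apply: tensP => i; rewrite tensD !sum_ffunE; case E: [pick z | rep i z] => [pq|].
      rewrite (bigD1 pq) //= !ffunE E eqxx big1 => [|z]; last first.
        rewrite !ffunE E => /negbTE; rewrite eq_sym => zpq.
        by case: eqP => // -[] e; rewrite e eqxx in zpq.
      rewrite big1 ?addr0 // => g hg; rewrite ffunE; case: ifP => // si.
      move: E; case: pickP => // -[p q] /and4P[/= cp cq pq' /eqP ipq] _.
      case/eqP: pq'; apply: (@perm_inj _ g^-1%g); have hg' : fixlt c g^-1%g by rewrite fixltV.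
      by apply: (sorted_from_inj si); rewrite ?fixlt_ge // !ffunE !permKV.
    rewrite big1 ?add0r => [|pq _]; last by rewrite ffunE E.
    have [|g hg sg] := @sorting_perm _ _ c i.
      move=> p q cp cq ipq; apply/eqP; apply: contraT => pq.
      by move: E; case: pickP => // /(_ (p, q)); rewrite /rep /= cp cq pq ipq eqxx.
    rewrite (bigD1 g) //= ffunE sg big1 ?addr0 // => h /andP[hh hgh].
    rewrite ffunE; case: ifP => // sh; case/negP: hgh; apply/eqP.
    apply: (mulIg g^-1%g); rewrite mulgV.
    apply: (sorted_from_unique sg); first by rewrite fixltM ?fixltV.
    by rewrite permidxM mulgKV.
  apply: tensP => i; rewrite sum_ffunE [RHS]ffunE.
  transitivity (if sorted_from c i then alt c x i else 0); last by rewrite x0 ffunE if_same.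
  case: ifP => si.
    rewrite altE (reindex_inj invg_inj) /=; apply: eq_big => [g|g _].
      by rewrite fixltV.
    by rewrite sactE invgK ffunE permidxM mulVg permidx1 si.
  apply: big1 => g _; rewrite sactE ffunE permidxM mulgV permidx1 si mulr0 //.
apply: QD.
  by elim/big_ind: _ => // pq _; exact: Qr.
by elim/big_ind: _ => // g hg; exact: Qg.
Qed.
End Induction.
End AltKernel.

(** * Hook Weyl modules inside tensor space *)

Section HookModel.
Variables n r : nat.
Local Notation I := (multiidx n r).
Local Notation T := (tens n r).
Implicit Types (i j : I) (t u f : T) (p q : 'I_r) (g h s : 'S_r) (c : nat).

Definition minat i q := [forall x : 'I_r, (i q <= i x)%N].

Lemma minatP i q : reflect (forall x, (i q <= i x)%N) (minat i q).
Proof. exact: forallP. Qed.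

Lemma minat_perm i g q : minat (permidx i g) q = minat i (g q).
Proof.
apply/minatP/minatP => h x; last by rewrite !ffunE h.
by have := h (g^-1%g x); rewrite !ffunE permKV.
Qed.

Lemma minat_eq i p q : minat i p -> minat i q -> i p = i q.
Proof.
move=> /minatP hp /minatP hq; apply/val_inj/eqP.
by rewrite /= eqn_leq hp hq.
Qed.

Lemma minat_ex i : (0 < r)%N -> exists q, minat i q.
Proof.
move=> r0; case: (@arg_minnP _ (Ordinal r0) predT (fun q => i q : nat)) => // q _ hq.
by exists q; apply/minatP=> x; exact: hq.
Qed.

(** Composing [s] with an exchange of two equal letters makes it fix the place [c], so that only the
    first [c] places are permuted. *)
Lemma symtens_same_place c (cr : (c < r)%N) f i s :
  f \in symtens c -> fixge c.+1 s ->
  permidx i s (Ordinal cr) = i (Ordinal cr) -> f (permidx i s) = f i.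
Proof.
set pc := Ordinal cr; move=> hf hs; rewrite ffunE => isc.
have pc1 : (s pc < c.+1)%N by rewrite fixge_lt.
pose s' := (tperm pc (s^-1%g pc) * s)%g.
have -> : permidx i s = permidx i s'.
  rewrite /s' -permidxM permidx_tperm_id // !ffunE permKV.
  exact: isc.
rewrite (symtens_fixge _ hf) //; apply/fixgeP=> p; rewrite leq_eqVlt permM.
have hs' : (s^-1%g pc < c.+1)%N.
  rewrite ltnNge; apply/negP=> h; have := fixgeP _ _ hs _ h.
  by rewrite permKV => e; rewrite -e /= ltnn in h.
case/orP=> [/eqP pE|cp].
  have -> : p = pc by apply: val_inj.
  by rewrite tpermL permKV.
rewrite tpermD ?(fixgeP _ _ hs) //.
  by apply: contraTneq cp => <-; rewrite /= ltnn.
by apply: contraTneq cp => <-; rewrite -leqNgt -ltnS.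
Qed.

Lemma alt_sorted c t i : (forall g, fixlt c g -> g != 1%g -> t (permidx i g) = 0) ->
  alt c t i = t i.
Proof.
move=> ht; rewrite altE (bigD1 1%g) ?fixlt1 //= odd_perm1 mul1r permidx1.
by rewrite big1 ?addr0 // => g /andP[hg g1]; rewrite ht ?mulr0.
Qed.

Lemma antisym_ext c f f' i : antisym c f -> antisym c f' ->
  (forall g, fixlt c g -> sorted_from c (permidx i g) -> f (permidx i g) = f' (permidx i g)) ->
  f i = f' i.
Proof.
move=> af af' ff'; pose rep (z : 'I_r * 'I_r) :=
  [&& (c <= z.1)%N, (c <= z.2)%N, z.1 != z.2 & i z.1 == i z.2].
case: (pickP rep) => [[p q] /and4P[/= cp cq pq /eqP ipq]|norep].
  by rewrite (antisym_repeat af cp cq pq ipq) (antisym_repeat af' cp cq pq ipq).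
have [|g hg sg] := @sorting_perm _ _ c i.
  move=> p q cp cq ipq; apply/eqP; apply: contraT => pq.
  by have := norep (p, q); rewrite /rep /= cp cq pq ipq eqxx.
have := ff' g hg sg; rewrite af // af' // => /(congr1 (fun y => (-1) ^+ g * y)).
by rewrite !signM1.
Qed.

(* With u the smallest letter of a word, this is the homotopy
   u^(m-1) x (x) u /\ y |-> u^(m) x (x) y of the Koszul complex of D F (x) /\ F. *)
Lemma col_extension c (cr : (c < r)%N) f : f \in symtens c -> antisym c f ->
  exists2 t, t \in symtens c.+1 &
    forall i q, (c <= q)%N -> minat i q -> alt c t i = f i.
Proof.
set pc := Ordinal cr; move=> hf af.
(* The letter brought to place [c] is a smallest one among the first [c+1] places. In a [good] word
   the later places increase and avoid the smallest letter, so that the alternation of [t] has a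
   single term at the words tested below. *)
pose ok i p := (p < c.+1)%N && minat i p.
pose good i := sorted_from c.+1 i && [forall q : 'I_r, (c < q)%N ==> ~~ minat i q].
pose t : T := [ffun i => if good i then
  (if [pick p | ok i p] is Some p then f (permidx i (tperm pc p)) else 0) else 0].
have tE i p : good i -> ok i p -> t i = f (permidx i (tperm pc p)).
  move=> gi hp; rewrite ffunE gi; case: pickP => [p' hp'|/(_ p)]; last by rewrite hp.
  have -> : permidx i (tperm pc p') =
      permidx (permidx i (tperm pc p)) (tperm pc p' * tperm pc p)%g.
    by rewrite permidxM -mulgA tperm2 mulg1.
  have [/andP[pc1 mp] /andP[pc1' mp']] := (hp, hp').
  apply: (symtens_same_place (cr := cr)) => //.
    apply/fixgeP=> x cx; rewrite permM.
    have e1 : fixge c.+1 (tperm pc p') by rewrite fixge_tperm /=.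
    have e2 : fixge c.+1 (tperm pc p) by rewrite fixge_tperm /=.
    by rewrite (fixgeP _ _ e1) // (fixgeP _ _ e2).
  rewrite permidxM -mulgA tperm2 mulg1 !ffunE !tpermL.
  exact: minat_eq.
have goodP i s : fixge c.+1 s -> good (permidx i s) = good i.
  move=> hs; have fs (x : 'I_r) : (c < x)%N -> s x = x by move/(fixgeP _ _ hs).
  rewrite /good; congr (_ && _).
    apply/sorted_fromP/sorted_fromP => si p q cp pq; have := si _ _ cp pq;
      by rewrite !ffunE !fs // (leq_trans cp) // ltnW.
  by apply: eq_forallb => q; case: ltnP => //= cq; rewrite minat_perm fs.
exists t.
  apply: fixge_symtens => s i hs; have := goodP i s hs.
  case gi: (good i) => gis; last by rewrite !ffunE gi gis.
  case: (pickP (ok i)) => [p hp|no]; last first.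
    rewrite !ffunE gi gis; case: pickP => [p hp|_]; case: pickP => [p' hp'|_] //;
      try by have := no p'; rewrite hp'.
    by case/andP: hp; rewrite minat_perm => pc1 mp; have := no (s p); rewrite /ok fixge_lt ?mp.
  have hp' : ok (permidx i s) (s^-1%g p).
    case/andP: hp => pc1 mp; rewrite /ok minat_perm permKV mp andbT.
    rewrite ltnNge; apply/negP=> h; have := fixgeP _ _ hs _ h.
    by rewrite permKV => e; rewrite -e leqNgt pc1 in h.
  rewrite (tE _ _ gis hp') (tE _ _ gi hp).
  have -> : permidx (permidx i s) (tperm pc (s^-1%g p)) =
      permidx (permidx i (tperm pc p)) (tperm pc (s^-1%g p) * s * tperm pc p)%g.
    by rewrite !permidxM -!mulgA tperm2 mulg1.
  have [/andP[pc1 mp] /andP[pc1' mp']] := (hp, hp').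
  apply: (symtens_same_place (cr := cr)) => //.
    have e1 : fixge c.+1 (tperm pc p) by rewrite fixge_tperm /=.
    have e2 : fixge c.+1 (tperm pc (s^-1%g p)) by rewrite fixge_tperm /=.
    apply/fixgeP=> x cx; rewrite !permM.
    by rewrite (fixgeP _ _ e2) // (fixgeP _ _ hs) // (fixgeP _ _ e1).
  by rewrite permidxM -!mulgA tperm2 mulg1 !ffunE permM !tpermL permKV.
(* By antisymmetry only words increasing from place [c] on matter; in such a word a smallest letter
   found there must stand at [c] itself. *)
move=> i q cq mq; apply: (antisym_ext (c := c)) => //; first exact: alt_antisym.
move=> g hg sg; have {sg}: sorted_from c (permidx i g) by [].
have : minat (permidx i g) (g^-1%g q) by rewrite minat_perm permKV.
have : (c <= g^-1%g q)%N by rewrite fixlt_ge // fixltV.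
move: {i cq mq hg} (permidx i g) (g^-1%g q) => {g} i q' cq mq si.
have q'c : q' = pc.
  apply/val_inj/eqP; rewrite /= eqn_leq cq andbT leqNgt; apply/negP=> cq'.
  have /sorted_fromP/(_ pc q' (leqnn c) cq') := si.
  by rewrite ltnNge => /negP; apply; move/minatP: mq.
subst q'.
have gi : good i.
  apply/andP; split.
    by apply/sorted_fromP=> p x cp; move/sorted_fromP: si; apply; exact: ltnW.
  apply/forallP=> x; apply/implyP=> cx; apply/negP=> /(minat_eq mq)/eqP.
  apply/negP; have /sorted_fromP/(_ pc x (leqnn c) cx) := si.
  by apply: contraTneq => ->; rewrite ltnn.
rewrite alt_sorted; last first.
  move=> g hg g1; rewrite ffunE; case: ifP => // gig.
  case/negP: g1; apply/eqP; apply: (sorted_from_unique si hg).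
  case/andP: gig => sg /forallP mg.
  have gc : g pc = pc.
    have := mg (g^-1%g pc); rewrite minat_perm permKV mq implybF -leqNgt => h.
    apply: (can_inj (permK g^-1%g)); rewrite permK; apply/val_inj/eqP.
    by rewrite /= eqn_leq h fixlt_ge ?fixltV.
  apply/sorted_fromP=> p x; rewrite leq_eqVlt => /orP[/eqP cp|cp px]; last first.
    exact: (sorted_fromP _ _ sg).
  have -> : p = pc by apply/val_inj.
  move=> cx; have := mg x; rewrite cx /= !ffunE gc minat_perm => mgx.
  rewrite ltn_neqAle (minatP _ _ mq) andbT; apply: contra mgx => /eqP e.
  by apply/minatP=> y; rewrite -e; exact: (minatP _ _ mq).
by rewrite (tE i pc) ?tperm1 ?permidx1 // /ok /= ltnSn.
Qed.

(* The image of Delta(c+1, 1^(r-c-1)) under [alt c]; the last condition says that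
   t lies in the kernel of D_c F (x) /\^(r-c) F -> D_(c-1) F (x) /\^(r-c+1) F. *)
Definition weyl c t := [/\ t \in symtens c, antisym c t &
  forall p i, (p < c)%N -> t i = \sum_(q : 'I_r | (c <= q)%N) t (permidx i (tperm p q))].

(** Call the first [c] places the row and the others the column. The relation at a row place with a
    smallest letter moves this letter into the column, so the coefficients at words with a smallest
    letter in the column determine all the others. *)
Lemma weyl_ext c t u : (0 < r)%N -> weyl c t -> weyl c u ->
  (forall i q, (c <= q)%N -> minat i q -> t i = u i) -> t = u.
Proof.
move=> r0 [_ _ gt] [_ _ gu] tu; apply: tensP => i.
have [p mp] := minat_ex i r0; have [cp|pc] := leqP c p; first exact: tu mp.
rewrite (gt p) // (gu p) //; apply: eq_bigr => q cq; apply: (tu _ q cq).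
by rewrite minat_perm tpermR.
Qed.

(** As [t] is symmetric in the places [c-1] and [c], its alternation from place [c-1] on vanishes;
    [alt_rec] turns this into the relation for [p = c-1], and row symmetry conjugates it to every
    other [p]. *)
Lemma weyl_alt c t : (0 < c)%N -> (c < r)%N -> t \in symtens c.+1 -> weyl c (alt c t).
Proof.
move=> c0 cr ht.
have hc : alt c t \in symtens c.
  by apply: symtens_alt => //; apply: symtensS.
split=> //; first exact: alt_antisym.
have c1r : (c.-1 < r)%N by rewrite (leq_ltn_trans (leq_pred c)).
pose p1 := Ordinal c1r; pose pc := Ordinal cr.
have p1c : (p1 < c)%N by rewrite /= prednK.
have a0 : alt c.-1 t = 0.
  apply: (@alt_sym0 _ _ _ p1 pc) => //=; first by rewrite leq_pred.
    by apply/eqP=> /(congr1 val) /=; move: c0; case: (c) => //= m _; lia.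
  by move=> i; rewrite (symtens_fixge _ ht) // fixge_tperm //= ltnW.
have g1 i : alt c t i = \sum_(q : 'I_r | (c <= q)%N) alt c t (permidx i (tperm p1 q)).
  have := alt_rec c1r t i; rewrite a0 ffunE prednK // => /esym/eqP.
  rewrite subr_eq0 => /eqP ->; apply: eq_bigl => q.
  by move: c0; case: (c).
move=> p i pc'; rewrite -(symtens_fixge (s := tperm p p1) i hc) ?fixge_tperm // g1.
apply: eq_bigr => q cq; rewrite permidxM.
rewrite -(symtens_fixge (s := tperm p p1) _ hc) ?fixge_tperm // permidxM.
congr (alt c t (permidx i _)).
have := tpermJ p1 q (tperm p p1); rewrite tpermR [tperm p p1 q]tpermD; last 2 first.
- by apply: contraTneq cq => <-; rewrite -ltnNge.
- by apply: contraTneq cq => <-; rewrite -ltnNge.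
by move<-; rewrite /conjg tpermV mulgA.
Qed.

Lemma weyl_surj c t : (0 < c)%N -> (c < r)%N -> weyl c t ->
  exists2 u, u \in symtens c.+1 & alt c u = t.
Proof.
move=> c0 cr [ht at_ gt]; have [u hu uE] := col_extension cr ht at_.
exists u => //; apply: (@weyl_ext c); rewrite ?(leq_ltn_trans _ cr) //.
exact: weyl_alt.
Qed.

Lemma sym_alttens c u p q : (c <= p)%N -> (c <= q)%N -> p != q ->
  (forall i, u (permidx i (tperm p q)) = u i) -> u \in alttens c.
Proof.
move=> cp cq pq up.
have [pq'|qp|e] := ltngtP p q; first exact: alttens_swap cp pq' up.
  by apply: alttens_swap cq qp _ => i; rewrite tpermC up.
by case/eqP: pq; apply: val_inj.
Qed.

Lemma alt_kernel_alttens c t : t \in symtens c -> alt c t = 0 -> t \in alttens c.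
Proof.
move: t; apply: alt_kernel_ind => [|u v|u p q _]; first exact: rpred0.
  exact: rpredB.
exact: sym_alttens.
Qed.

Lemma sub_sact_alttens c g u : fixlt c g -> u \in symtens c -> u - sact g u \in alttens c.
Proof.
apply: (sub_sact_ind (Q := fun t => t \in alttens c)) => [|{}u v|{}u p q _]; first exact: rpred0.
  exact: rpredB.
exact: sym_alttens.
Qed.

(** Exactness of the Koszul complex at D_(c+1) F (x) /\^(r-c-1) F. [col_extension] gives [u] such
    that [alt c.+1 (t - u)] vanishes at words with a smallest letter after place [c]; as
    [alt c (t - u) = 0], [alt_rec] carries the vanishing to all other words. *)
Lemma alt_kernel c t : (c.+1 < r)%N -> t \in symtens c.+1 -> alt c t = 0 ->
  exists2 u, u \in symtens c.+2 & t - u \in alttens c.+1.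
Proof.
move=> c1r ht t0; have cr := ltnW c1r.
have [u hu uE] := col_extension c1r (symtens_alt (leqnn _) ht) (@alt_antisym _ _ _ t).
exists u => //; have hu1 : u \in symtens c.+1 := symtensS hu.
have hx : t - u \in symtens c.+1 by rewrite rpredB.
apply: alt_kernel_alttens => //.
pose pc := Ordinal cr; pose pd := Ordinal c1r.
have x0 : alt c (t - u) = 0.
  rewrite raddfB /= t0 sub0r (@alt_sym0 _ _ _ pc pd) ?oppr0 //=.
    by apply/eqP=> /(congr1 val) /= e; have := ltnSn c; rewrite {1}e ltnn.
  by move=> i; rewrite (symtens_fixge _ hu) ?fixge_tperm.
have xcol i q : (c < q)%N -> minat i q -> alt c.+1 (t - u) i = 0.
  by move=> cq mq; rewrite raddfB /= tensD tensN (uE i q) // subrr.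
apply: tensP => i; rewrite [RHS]ffunE.
have [p mp] := minat_ex i (leq_ltn_trans (leq0n _) cr).
have [cp|pc'] := ltnP c p; first exact: xcol mp.
rewrite -(symtens_fixge (s := tperm pc p) i (symtens_alt (leqnn _) hx)); last first.
  by rewrite fixge_tperm.
have := alt_rec cr (t - u) (permidx i (tperm pc p)).
rewrite x0 ffunE big1 ?subr0 // => q cq; apply: (xcol _ q) => //.
by rewrite !minat_perm tpermR tpermL.
Qed.

End HookModel.

(** * Ext^1 from a cyclic projective cover *)

Section ExtPresentation.
Variables (R : pzRingType) (M N P : lmodType R) (pi : {linear P -> M}).
(** [sigma] splits the map [A |-> A *: e] from R onto P; this is the form in which the projectivity
    of the cyclic module P enters. *)
Variables (e : P) (sigma : P -> R).
Hypothesis pi_surj : forall m, exists p, pi p = m.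
Hypothesis sigma_linear : forall A t u, sigma (A *: t + u) = A * sigma t + sigma u.
Hypothesis sigmaK : forall t, sigma t *: e = t.

Section Free.
Variable V : lmodType R.

Lemma fdelta_subproof (x : V) :
  (fun y => (y == x)%:R : R^o) \in @finsupp_fun R V.
Proof.
apply/asboolP; apply: sub_finite_set (finite_set1 x) => y /=.
by case: (y =P x) => // _; rewrite eqxx.
Qed.

Definition fdelta (x : V) : freemod V := Lsub (fdelta_subproof x).

Lemma freemod_eval_delta x : freemod_eval (fdelta x) = x.
Proof.
rewrite (freemod_evalE (A := [set x]%classic)) //; last first.
  by move=> y /=; case: (y =P x) => // _; rewrite eqxx.
by rewrite fsbig_set1 /= eqxx scale1r.
Qed.

Definition freemod_lift (W : lmodType R) (phi : V -> W) (f : freemod V) : W :=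
  \sum_(x \in [set: V]) (val f x : R) *: phi x.

Lemma freemod_liftE (W : lmodType R) (phi : V -> W) (f : freemod V) (A : set V) :
  finite_set A -> ([set x | val f x != 0] `<=` A)%classic ->
  freemod_lift phi f = \sum_(x \in A) (val f x : R) *: phi x.
Proof.
move=> finA fA; rewrite /freemod_lift; symmetry.
apply: fsbig_widen => // x [_ /= nAx]; have [->|fx0] := eqVneq (val f x) 0.
  by rewrite scale0r.
by case: nAx; exact: fA.
Qed.

Lemma freemod_lift_linear (W : lmodType R) (phi : V -> W) : linear (freemod_lift phi).
Proof.
move=> a f g; pose S (h : freemod V) := [set x | val h x != 0]%classic.
have finS h : finite_set (S h) by exact/asboolP/(valP h).
pose A := (S (a *: f + g) `|` (S f `|` S g))%classic.
have finA : finite_set A by rewrite !finite_setU; split; [|split]; exact: finS.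
rewrite !(@freemod_liftE _ _ _ A) //; try by move=> x Sx; do ?[by left | right].
rewrite !(fsbig_finite _ _ finA) /= scaler_sumr -big_split /=.
by apply: eq_bigr => x _; rewrite scalerA -scalerDl.
Qed.

Lemma linear_freemod_lift (W W' : lmodType R) (g : {linear W -> W'}) (phi : V -> W) f :
  g (freemod_lift phi f) = freemod_lift (g \o phi) f.
Proof.
have finS : finite_set [set x | val f x != 0]%classic by exact/asboolP/(valP f).
rewrite !(freemod_liftE _ finS) // !(fsbig_finite _ _ finS) /= linear_sum.
by apply: eq_bigr => x _; rewrite linearZ.
Qed.
Lemma relP (x : relmod V) : freemod_eval (val x) = 0.
Proof. by have := valP x; rewrite inE => /eqP. Qed.
End Free.

(* A homomorphism on the kernel of [pi] is represented by a function on [P]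
   whose values outside the kernel are irrelevant. *)
Definition klinear (h : P -> N) :=
  forall A t u, pi t = 0 -> pi u = 0 -> h (A *: t + u) = A *: h t + h u.

Definition extends (h : P -> N) :=
  exists2 g : P -> N, linear g & forall t, pi t = 0 -> h t = g t.

Definition mkrel (w : freemod M) : relmod M := insubd 0 w.

Lemma mkrelK w : freemod_eval w = 0 -> val (mkrel w) = w.
Proof. by move=> w0; rewrite insubdK // inE w0. Qed.

(** [theta] and [chi] are comparison maps over M between P and the term [freemod M] of the canonical
    resolution: the first exists thanks to [sigma], the second because [freemod M] is free. *)
Definition theta (t : P) : freemod M := sigma t *: fdelta (pi e).

Lemma theta_linear A t u : theta (A *: t + u) = A *: theta t + theta u.
Proof. by rewrite /theta sigma_linear scalerDl scalerA. Qed.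

Lemma theta_eval t : freemod_eval (theta t) = pi t.
Proof. by rewrite linearZ /= freemod_eval_delta -linearZ /= sigmaK. Qed.

Definition sect (m : M) : P := projT1 (cid (pi_surj m)).

Lemma sectK m : pi (sect m) = m.
Proof. exact: projT2 (cid (pi_surj m)). Qed.

Definition chi : freemod M -> P := freemod_lift sect.

Lemma chi_linear : linear chi.
Proof. exact: freemod_lift_linear. Qed.

Lemma chi_eval w : pi (chi w) = freemod_eval w.
Proof.
rewrite /chi linear_freemod_lift /freemod_eval; apply: eq_fsbigr => x _.
by rewrite /= sectK.
Qed.

Implicit Types f : cocycles M N 1.

Lemma cocycleP f : linear f /\ forall x, f (freeres_d x) = 0.
Proof. by have /asboolP := cocycle_valP f. Qed.

(* The map on the first syzygy through which the 1-cocycle [f] factors. *)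
Definition onrel f (x : relmod M) : N := f (fdelta x).

(** [w] and the basis vector at its image differ by an element of the second syzygy, which is a
    boundary and is therefore killed by [f]. *)
Lemma cocycle_onrel f w : f w = onrel f (freemod_eval w).
Proof.
have [lf f0] := cocycleP f; apply/eqP; rewrite /onrel -subr_eq0; apply/eqP.
pose y : relmod (relmod M) := insubd 0 (w - fdelta (freemod_eval w)).
have yK : val y = w - fdelta (freemod_eval w).
  by rewrite insubdK // inE linearB /= freemod_eval_delta subrr.
have := f0 (fdelta y); rewrite /freeres_d freemod_eval_delta.
rewrite -[lsub_val y]/(val y) yK => <-.
by rewrite [in RHS]addrC -[in RHS]scaleN1r lf scaleN1r addrC.
Qed.

Lemma onrel_linear f : linear (onrel f).
Proof.
have [lf _] := cocycleP f => A x y.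
rewrite -{1}[x]freemod_eval_delta -{1}[y]freemod_eval_delta -linearP.
by rewrite -cocycle_onrel lf.
Qed.

Definition cocycle_hom f (t : P) : N := onrel f (mkrel (theta t)).

Lemma mkrelD A w w' : freemod_eval w = 0 -> freemod_eval w' = 0 ->
  mkrel (A *: w + w') = A *: mkrel w + mkrel w'.
Proof.
move=> w0 w'0; apply: val_inj; rewrite linearP /= !mkrelK //.
by rewrite linearP /= w0 w'0 scaler0 addr0.
Qed.

Lemma cocycle_hom_klinear f : klinear (cocycle_hom f).
Proof.
move=> A t u t0 u0; rewrite /cocycle_hom theta_linear mkrelD ?theta_eval //.
exact: onrel_linear.
Qed.

Lemma cocycle_homB f f' t : cocycle_hom (f - f') t = cocycle_hom f t - cocycle_hom f' t.
Proof. by []. Qed.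

(** In one direction, compose with [theta]. In the other, split [w] as [w - theta (chi w)] plus
    [theta (chi w)]: the first summand is a relation for every [w], so [onrel f] applies to it, and
    the extension [g] takes care of the second. *)
Lemma coboundaryP f : f \in @coboundary _ M N 1 <-> extends (cocycle_hom f).
Proof.
have [lf f0] := cocycleP f; split=> [/asboolP[g lg fg]|[g lg hg]].
  exists (fun t => g (theta t)).
    by move=> A t u; rewrite theta_linear lg.
  move=> t t0; rewrite /cocycle_hom /onrel fg /freeres_d freemod_eval_delta.
  by rewrite -[lsub_val _]/(val _) mkrelK // theta_eval.
pose rho w := w - theta (chi w).
have rho0 w : freemod_eval (rho w) = 0 by rewrite linearB /= theta_eval chi_eval subrr.
have rho_lin A w w' : rho (A *: w + w') = A *: rho w + rho w'.
  by rewrite /rho chi_linear theta_linear scalerBr opprD addrACA.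
apply/asboolP; exists (fun w => onrel f (mkrel (rho w)) + g (chi w)).
  move=> A w w'; rewrite rho_lin mkrelD // onrel_linear chi_linear lg.
  by rewrite addrACA -scalerDr.
move=> w; rewrite cocycle_onrel; set x := freemod_eval w.
have x0 := relP x.
rewrite /freeres_d -/x -[lsub_val x]/(val x).
have k0 : pi (chi (val x)) = 0 by rewrite chi_eval.
rewrite -hg // /cocycle_hom -[X in X + _]scale1r -onrel_linear; congr (onrel f _).
by rewrite -mkrelD ?theta_eval // scale1r /rho subrK; apply: val_inj; rewrite mkrelK.
Qed.

(** [h \o chi] on relations is a cocycle, and it restricts to [h (chi (theta t))] on the kernel of
    [pi]. Since [chi (theta t) - t] lies in this kernel for every [t], the difference from [h] is
    defined on all of P. *)
Lemma klinear_cocycle h : klinear h ->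
  exists f : cocycles M N 1, extends (fun t => cocycle_hom f t - h t).
Proof.
move=> hk; have h0 : h 0 = 0.
  by have := hk (-1) 0 0 (linear0 _) (linear0 _); rewrite !scaleN1r addr0 oppr0 addNr.
pose F (w : freeres M 1) : N := h (chi (val (freemod_eval w : relmod M))).
have F_c : F \in @cocycle _ M N 1.
  apply/asboolP; split.
    move=> A w w'; rewrite /F.
    have -> : val (freemod_eval (A *: w + w') : relmod M) =
        A *: val (freemod_eval w : relmod M) + val (freemod_eval w' : relmod M).
      by rewrite !linearP.
    rewrite chi_linear hk //.
      by rewrite chi_eval relP.
    by rewrite chi_eval relP.
  move=> w; rewrite /F /freeres_d.
  set y : relmod (relmod M) := freemod_eval w.
  rewrite relP; rewrite [val 0](linear0 val) /chi.
  suff -> : freemod_lift sect 0 = 0 by [].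
  by have := freemod_lift_linear sect (-1) 0 0; rewrite !scaleN1r oppr0 addr0 addNr.
pose f := Cocycle F_c; exists f.
have fE t : pi t = 0 -> cocycle_hom f t = h (chi (theta t)).
  move=> t0; rewrite /cocycle_hom /onrel /= /F freemod_eval_delta mkrelK //.
  by rewrite theta_eval.
exists (fun t => h (chi (theta t) - t)); last first.
  move=> t t0; rewrite fE // -[RHS]addr0.
  have k0 : pi (chi (theta t)) = 0 by rewrite chi_eval theta_eval.
  by have := hk (-1) t (chi (theta t)) t0 k0; rewrite !scaleN1r ![- _ + _]addrC addr0 => ->.
move=> A t u.
have kk v : pi (chi (theta v) - v) = 0.
  by rewrite linearB /= chi_eval theta_eval subrr.
rewrite -hk //; congr h; rewrite theta_linear chi_linear.
by rewrite opprD addrACA -scalerBr.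
Qed.

Definition ext_class f : Ext M N 1 := (\pi_({ideal_quot (@coboundary R M N 1)})%qT f).

Lemma ext_class_surj (x : Ext M N 1) : exists f, x = ext_class f.
Proof.
exists (generic_quotient.repr (x : {ideal_quot (@coboundary R M N 1)})).
by rewrite /ext_class reprK.
Qed.

Lemma ext_class_eq f f' : ext_class f = ext_class f' <-> extends (cocycle_hom (f - f')).
Proof.
rewrite -coboundaryP Quotient.idealrBE.
by split=> [h|/eqP //]; apply/eqP.
Qed.

Lemma ext_class_eq0 f : ext_class f = 0 <-> extends (cocycle_hom f).
Proof.
rewrite -coboundaryP -[f in f \in _]subr0 Quotient.idealrBE.
have e0 : ext_class 0 = 0 by exact: (raddf0 (\pi_({ideal_quot (@coboundary R M N 1)})%qT)).
by split=> [h|/eqP h]; [apply/eqP; rewrite -e0 in h|rewrite -e0].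
Qed.

Lemma extendsB (h h' : P -> N) : extends h -> extends h' -> extends (fun t => h t - h' t).
Proof.
move=> [g lg hg] [g' lg' hg']; exists (fun t => g t - g' t).
  by move=> A t u; rewrite lg lg' scalerBr opprD addrACA.
by move=> t t0; rewrite hg ?hg'.
Qed.

Lemma extends_ext (h h' : P -> N) : (forall t, h t = h' t) -> extends h -> extends h'.
Proof. by move=> hh' [g lg hg]; exists g => // t t0; rewrite -hh' hg. Qed.

Theorem Ext1_trivial : (forall h, klinear h -> extends h) -> forall x : Ext M N 1, x = 0.
Proof.
move=> ext x; have [f ->] := ext_class_surj x.
by apply/ext_class_eq0/ext/cocycle_hom_klinear.
Qed.

Theorem Ext1_Z2 h0 : klinear h0 -> ~ extends h0 ->
  (forall h, klinear h -> extends h \/ extends (fun t => h t - h0 t)) ->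
  exists f : {additive Ext M N 1 -> 'Z_2}, bijective f.
Proof.
move=> kh0 nh0 h0P; have [f0 ef0] := klinear_cocycle kh0.
pose x0 := ext_class f0.
have x0n : x0 != 0.
  apply/eqP=> /ext_class_eq0 e0; apply: nh0.
  by apply: extends_ext (extendsB e0 ef0) => t; rewrite opprB addrC subrK.
have xE (x : Ext M N 1) : x = 0 \/ x = x0.
  have [f ->] := ext_class_surj x.
  have [ef|ef] := h0P _ (@cocycle_hom_klinear f).
    by left; apply/ext_class_eq0.
  right; apply/ext_class_eq; apply: extends_ext (extendsB ef ef0) => t.
  by rewrite cocycle_homB opprB addrA subrK.
pose F (x : Ext M N 1) : 'Z_2 := if x == 0 then 0 else 1.
have F_additive : zmod_morphism F.
  move=> x y; rewrite /F; have [->|->] := xE x; have [->|->] := xE y.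
  - by rewrite subrr eqxx subrr.
  - by rewrite sub0r oppr_eq0 eqxx (negbTE x0n); apply/val_inj.
  - by rewrite subr0 eqxx (negbTE x0n) subr0.
  - by rewrite subrr eqxx (negbTE x0n) subrr.
pose Fa : {additive Ext M N 1 -> 'Z_2} :=
  HB.pack F (GRing.isZmodMorphism.Build _ _ F F_additive).
exists Fa; exists (fun z : 'Z_2 => if z == 0 then 0 else x0) => [x|z] /=; rewrite /F.
  by have [->|->] := xE x; rewrite ?eqxx // (negbTE x0n).
have [->|z0] := eqVneq z 0; first by rewrite eqxx.
rewrite (negbTE x0n); apply/val_inj; move: z z0 => [[|[|m]] hm] //.
Qed.
End ExtPresentation.

(** * Presentation and embedding of hook Weyl modules *)

Section Presentation.

Lemma linear_factor (R : pzRingType) (P M W : lmodType R)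
    (pi : {linear P -> M}) (g : {linear P -> W}) :
  (forall m, exists p, pi p = m) -> (forall t, pi t = 0 <-> g t = 0) ->
  exists2 iota : {linear M -> W}, injective iota & forall t, iota (pi t) = g t.
Proof.
move=> ps pg; pose s m := projT1 (cid (ps m)).
have sK m : pi (s m) = m := projT2 (cid (ps m)).
have gE t u : pi t = pi u -> g t = g u.
  move=> e; apply/eqP; rewrite -subr_eq0 -linearB; apply/eqP/pg.
  by rewrite linearB e subrr.
have L : linear (g \o s).
  by move=> A x y; rewrite /= -linearP; apply: gE; rewrite linearP !sK.
pose iota : {linear M -> W} := HB.pack (g \o s) (GRing.isLinear.Build _ _ _ _ _ L).
exists iota => [x y e|t]; last by apply: gE; rewrite sK.
rewrite -[x]sK -[y]sK; apply/eqP; rewrite -subr_eq0 -linearB; apply/eqP/pg.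
by rewrite linearB; apply/eqP; rewrite subr_eq0; apply/eqP.
Qed.

Variables n r : nat.
Local Notation T := (tens n r).

Lemma lquot_pi_eq0 (R : pzRingType) (V : lmodType R) (U : submodClosed V) x :
  lquot_pi U x = 0 <-> x \in U.
Proof.
rewrite -(linear0 (lquot_pi U)); split=> [/lquot_piP|h]; first by rewrite subr0.
by apply/lquot_piP; rewrite subr0.
Qed.

Lemma hookWeyl_presentation a : (a < r)%N ->
  exists pi : {linear lsub (@symtens n r a) -> hookWeyl n r a},
    (forall m, exists p, pi p = m) /\
    forall t, pi t = 0 <-> exists2 u, u \in symtens a.+1 & val t - u \in alttens a.
Proof.
move=> ar; rewrite /hookWeyl ar.
pose U1 := @symalt_rel n r a a; pose f := mult n r a \o comult n r a.
pose pi1 : {linear lsub (@symtens n r a) -> symalt n r a a} := lquot_pi U1.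
pose pi2 : {linear symalt n r a a -> lcoker f} := lquot_pi (lrange f).
exists (pi2 \o pi1); split=> [m|t].
  by exists (lquot_repr (lquot_repr m)); rewrite /= !lquot_reprK.
have fE v : f (lquot_pi _ v) = lquot_pi U1 (symtens_incl v).
  transitivity (mult n r a (lquot_pi _ (symtens_incl v))); last exact: lquot_mapE.
  by congr (mult n r a _); exact: lquot_mapE.
have U1E x : (x \in U1) = (lsub_val x \in alttens a) by [].
rewrite /= lquot_pi_eq0; split=> [/asboolP[x]|[u hu tu]].
  rewrite -[x]lquot_reprK => /(etrans (esym (fE _)))/lquot_piP.
  rewrite U1E linearB -opprB rpredN => h.
  by exists (lsub_val (lquot_repr x)); first exact: lsub_valP.
apply/asboolP; exists (lquot_pi _ (Lsub hu)); apply: etrans (fE _) _.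
by apply/lquot_piP; rewrite U1E linearB -opprB rpredN.
Qed.

(** On [symtens c.+1], the kernel of [alt c] consists of the relations of the presentation
    ([alt_kernel]), and its image is cut out by [weyl c] ([weyl_alt], [weyl_surj]). *)
Lemma hookWeyl_embedding c : (0 < c)%N -> (c < r)%N ->
  exists iota : {linear hookWeyl n r c.+1 -> T},
    [/\ injective iota, forall x, weyl c (iota x) &
        forall t, weyl c t -> exists x, iota x = t].
Proof.
move=> c0 cr; pose g : {linear lsub (@symtens n r c.+1) -> T} := alt c \o @lsub_val _ _ _.
suff [pi [ps pg]] : exists pi : {linear lsub (@symtens n r c.+1) -> hookWeyl n r c.+1},
    (forall m, exists p, pi p = m) /\ forall t, pi t = 0 <-> g t = 0.
  have [iota ji iE] := linear_factor ps pg; exists iota; split=> // [x|t ht].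
    by have [t <-] := ps x; rewrite iE; apply: weyl_alt => //; exact: lsub_valP.
  have [u hu ut] := weyl_surj c0 cr ht.
  by exists (pi (Lsub hu)); rewrite iE.
have [c1r|rc] := ltnP c.+1 r.
  have [pi [ps pk]] := hookWeyl_presentation c1r; exists pi; split=> // t; split.
    move=> /pk[u hu tu]; pose pc := Ordinal cr; pose pd := Ordinal c1r.
    have au : alt c u = 0.
      apply: (@alt_sym0 _ _ _ pc pd) => //=.
        by apply/eqP=> /(congr1 val) /= e; have := ltnSn c; rewrite {1}e ltnn.
      by move=> i; rewrite (symtens_fixge _ hu) ?fixge_tperm.
    have : alt c (lsub_val t - u) = 0 by apply/alt_alttens/alttensS; exact: tu.
    by rewrite raddfB /= au subr0.
  by move=> gt; apply/pk; apply: alt_kernel => //; exact: lsub_valP.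
(* Here [c.+1 = r]: a single place is left to alternate, so [alt c] is the identity. *)
rewrite /hookWeyl ltnNge rc /=.
exists idfun; split=> [m|t]; first by exists m.
suff E : g t = lsub_val t.
  split=> [/= ->|h]; first by rewrite !linear0.
  by apply: val_inj; rewrite linear0 -h; exact: esym E.
apply: tensP => i; apply: alt_sorted => h hh; case/negP; apply/eqP/permP=> p.
rewrite perm1; have [pc|cp] := ltnP p c; first exact: (fixltP _ _ hh).
have eqc (x : 'I_r) : (c <= x)%N -> x = Ordinal cr.
  move=> cx; apply/val_inj/eqP; rewrite /= eqn_leq cx andbT -ltnS.
  exact: leq_trans (ltn_ord x) rc.
by rewrite (eqc _ (fixlt_ge hh cp)) (eqc _ cp).
Qed.

End Presentation.

(** * Elements of the Schur algebra *)

Section SchurElements.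
Variables n r : nat.
Local Notation I := (multiidx n r).
Local Notation T := (tens n r).
Implicit Types (i j : I) (t u v X : T) (p q : 'I_r) (g h s : 'S_r) (c : nat).

Lemma card_ord_ltn c : (c <= r)%N -> #|[pred p : 'I_r | (p < c)%N]| = c.
Proof. by move=> cr; rewrite -sum1_card -(big_ord_widen _ (fun=> 1%N)) // sum1_card card_ord. Qed.

Lemma card_ord_geq c : (c <= r)%N -> #|[pred p : 'I_r | (c <= p)%N]| = (r - c)%N.
Proof.
move=> cr; apply/eqP; rewrite -(eqn_add2l c) subnKC //.
have := cardC [pred p : 'I_r | (p < c)%N]; rewrite card_ord_ltn // card_ord => /eqP.
congr (_ + _ == _)%N; apply: eq_card => p; rewrite !inE /=.
by rewrite -leqNgt.
Qed.

Definition ebas i : T := [ffun j => (j == i)%:R].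

Lemma scale_ebas (A : schur n r) i j : (A *: ebas i) j = A (j, i).
Proof.
rewrite tens_scaleE (bigD1 i) //= ffunE eqxx mulr1 big1 ?addr0 // => k ki.
by rewrite ffunE (negbTE ki) mulr0.
Qed.

Definition letters (pi : 'S_n) i : I := [ffun p => pi (i p)].

Definition letp_fun (pi : 'S_n) : {ffun I * I -> int} :=
  [ffun ij => (ij.1 == letters pi ij.2)%:R].

Lemma letp_subproof pi : letp_fun pi \in @schur_pred n r.
Proof.
apply/schur_predP=> s i j; rewrite !ffunE /=.
have -> : letters pi (permidx j s) = permidx (letters pi j) s.
  by apply/ffunP=> p; rewrite !ffunE.
by rewrite (inj_eq (bij_inj (permidx_bij n s))).
Qed.

Definition letp pi : schur n r := Defs.Schur (letp_subproof pi).

Lemma letp_scale pi X i : (letp pi *: X) (letters pi i) = X i.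
Proof.
rewrite tens_scaleE (bigD1 i) //= ffunE /= eqxx mul1r big1 ?addr0 // => j ji.
rewrite ffunE /=; case: eqP => [e|_]; last by rewrite mul0r.
case/eqP: ji; apply/ffunP=> p; apply: (@perm_inj _ pi).
by have /ffunP/(_ p) := e; rewrite !ffunE.
Qed.

Definition casimir_fun : {ffun I * I -> int} :=
  [ffun ij => \sum_(p < r) \sum_(q < r) (ij.1 == permidx ij.2 (tperm p q))%:R].

Lemma casimir_subproof : casimir_fun \in @schur_pred n r.
Proof.
apply/schur_predP=> s i j; rewrite !ffunE /=.
rewrite (reindex_inj (@perm_inj _ s^-1%g)) /=; apply: eq_bigr => p _.
rewrite (reindex_inj (@perm_inj _ s^-1%g)) /=; apply: eq_bigr => q _.
have -> : permidx (permidx j s) (tperm (s^-1%g p) (s^-1%g q)) =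
    permidx (permidx j (tperm p q)) s.
  by rewrite !permidxM -tpermJ /conjg invgK -!mulgA mulVg mulg1.
by rewrite (inj_eq (bij_inj (permidx_bij n s))).
Qed.

(* The sum of all the transpositions (p q) of places, including p = q. *)
Definition casimir : schur n r := Defs.Schur casimir_subproof.

Lemma casimirE t i :
  (casimir *: t) i = \sum_(p < r) \sum_(q < r) t (permidx i (tperm p q)).
Proof.
rewrite tens_scaleE; under eq_bigr do rewrite ffunE /= mulr_suml.
rewrite exchange_big /=; apply: eq_bigr => p _.
under eq_bigr do rewrite mulr_suml.
rewrite exchange_big /=; apply: eq_bigr => q _.
rewrite (bigD1 (permidx i (tperm p q))) //= permidxM tperm2 permidx1 eqxx mul1r.
rewrite big1 ?addr0 // => j jn; case: (i =P _) => [ie|_]; last by rewrite mul0r.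
by move: jn; rewrite {1}ie permidxM tperm2 permidx1 eqxx.
Qed.

Lemma casimir_split c (F : 'I_r -> 'I_r -> int) : (forall p q, F p q = F q p) ->
  \sum_(p < r) \sum_(q < r) F p q = \sum_(p < r | (p < c)%N) \sum_(q < r | (q < c)%N) F p q +
    (\sum_(q < r | (c <= q)%N) \sum_(p < r | (p < c)%N) F p q) *+ 2 +
    \sum_(p < r | (c <= p)%N) \sum_(q < r | (c <= q)%N) F p q.
Proof.
move=> FC; have lt_ge (G : 'I_r -> int) :
    \sum_(q < r) G q = \sum_(q < r | (q < c)%N) G q + \sum_(q < r | (c <= q)%N) G q.
  rewrite (bigID (fun q : 'I_r => (q < c)%N)); congr (_ + _).
  by apply: eq_bigl => q; rewrite -leqNgt.
rewrite lt_ge; under eq_bigr do rewrite lt_ge.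
under [X in _ + X]eq_bigr do rewrite lt_ge.
rewrite !big_split /= mulr2n !addrA; congr (_ + _); rewrite -!addrA.
congr (_ + _); rewrite exchange_big /=; congr (_ + _).
by apply: eq_bigr => q _; apply: eq_bigr => p _.
Qed.

(** Put d = r - c - 1. Pairs of row places give c^2, the relations of [weyl] give 2c for the mixed
    pairs, and antisymmetry gives (d + 1)(1 - d) for pairs of column places. *)
Lemma casimir_weyl c t : (c < r)%N -> weyl c t ->
  casimir *: t = t *~ (c.+1%:Z ^+ 2 - (r - c.+1)%N%:Z ^+ 2).
Proof.
move=> cr [hs ha hg]; apply: tensP => i; rewrite ffunMzE casimirE (casimir_split c); last first.
  by move=> p q; rewrite tpermC.
have -> : \sum_(p < r | (p < c)%N) \sum_(q < r | (q < c)%N) t (permidx i (tperm p q)) =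
    t i *+ c *+ c.
  transitivity (\sum_(p < r | (p < c)%N) \sum_(q < r | (q < c)%N) t i).
    apply: eq_bigr => p pc; apply: eq_bigr => q qc.
    by rewrite (symtens_fixge _ hs) ?fixge_tperm.
  by rewrite !sumr_const !(card_ord_ltn (ltnW cr)).
have -> : \sum_(q < r | (c <= q)%N) \sum_(p < r | (p < c)%N) t (permidx i (tperm p q)) =
    t i *+ c.
  rewrite exchange_big /= -[X in _ *+ X](card_ord_ltn (ltnW cr)) -sumr_const.
  by apply: eq_bigr => p pc; rewrite -hg.
have -> : \sum_(p < r | (c <= p)%N) \sum_(q < r | (c <= q)%N) t (permidx i (tperm p q)) =
    (t i *+ 2 - t i *+ (r - c)) *+ (r - c).
  rewrite -[X in _ *+ X](card_ord_geq (ltnW cr)) -sumr_const; apply: eq_bigr => p cp.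
  rewrite -[X in _ - _ *+ X](card_ord_geq (ltnW cr)) -sumr_const.
  rewrite (bigD1 p) //= [X in _ = _ - X](bigD1 p) //= tperm1 permidx1 mulr2n.
  rewrite opprD addrACA subrr add0r -sumrN; congr (_ + _).
  by apply: eq_bigr => q /andP[cq qp]; rewrite (antisym_tperm _ ha) // eq_sym.
rewrite (_ : (r - c = (r - c.+1).+1)%N); last lia.
move: (r - c.+1)%N => d.
rewrite !pmulrn !mulrzz !intS; ring.
Qed.

(** Now the row has c + 1 places and gives (c + 1)^2. Modulo [alttens c], a transposition of two
    column places gives -t, and those of one column place with all row places add up to -t. With d =
    r - c - 1 the total is (c + 1)^2 - 2d + d - d(d - 1). *)
Lemma casimir_alttens c t : (c < r)%N -> t \in symtens c.+1 ->
  casimir *: t - t *~ (c.+1%:Z ^+ 2 - (r - c.+1)%N%:Z ^+ 2) \in alttens c.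
Proof.
move=> cr ht; pose pc := Ordinal cr.
pose act p q : T := [ffun i => t (permidx i (tperm p q))].
have actE p q i : act p q i = t (permidx i (tperm p q)) by rewrite ffunE.
pose f q : T := t + \sum_(p < r | (p < c.+1)%N) act p q.
have act_alt p q : (c < p)%N -> (c < q)%N -> p != q -> t + act p q \in alttens c.
  move=> cp cq pq; wlog pq' : p q cp cq pq / (p < q)%N.
    move=> wl; have [pq'|qp|e] := ltngtP p q; first exact: wl.
      have -> : act p q = act q p by apply/ffunP => i; rewrite !actE tpermC.
      by apply: wl => //; rewrite eq_sym.
    by case/eqP: pq; apply: val_inj.
  apply: (alttens_swap (ltnW cp) pq') => i.
  by rewrite !tensD !actE permidxM tperm2 permidx1 addrC.
(* Exchanging the places [c] and [q] swaps [t] with [act pc q], and fixes the other terms of [f q]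
   because [t] is symmetric in the row. *)
have f_alt q : (c < q)%N -> f q \in alttens c.
  move=> cq; apply: (@alttens_swap _ _ _ pc q) => // i.
  rewrite !tensD !sum_ffunE (bigD1 pc) //= [X in _ = _ + X](bigD1 pc) //= !actE.
  rewrite permidxM tperm2 permidx1 addrCA; congr (_ + (_ + _)).
  apply: eq_bigr => p /andP[pc1 pp]; rewrite !actE permidxM.
  have -> : (tperm p q * tperm pc q = tperm p pc * tperm p q)%g.
    rewrite (tpermC p pc) -[RHS](mulKg (tperm p q)) tpermV; congr (_ * _)%g.
    have := tpermJ pc p (tperm p q); rewrite tpermL tpermD //.
      by rewrite /conjg tpermV mulgA.
    by apply: contraTneq cq => ->; rewrite ltnn.
  by rewrite -permidxM (symtens_fixge _ ht) // fixge_tperm.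
suff -> : casimir *: t - t *~ (c.+1%:Z ^+ 2 - (r - c.+1)%N%:Z ^+ 2) =
    \sum_(p < r | (c < p)%N) \sum_(q < r | (c < q)%N && (q != p)) (t + act p q) +
    (\sum_(q < r | (c < q)%N) f q) *+ 2.
  rewrite rpredD ?rpredMn ?rpred_sum // => p cp; rewrite ?f_alt //.
  by rewrite rpred_sum // => q /andP[cq qp]; rewrite act_alt // eq_sym.
apply: tensP => i; rewrite !tensD tensN ffunMzE casimirE (casimir_split c.+1); last first.
  by move=> p q; rewrite tpermC.
have -> : \sum_(p < r | (p < c.+1)%N) \sum_(q < r | (q < c.+1)%N) t (permidx i (tperm p q)) =
    t i *+ c.+1 *+ c.+1.
  transitivity (\sum_(p < r | (p < c.+1)%N) \sum_(q < r | (q < c.+1)%N) t i).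
    apply: eq_bigr => p pc1; apply: eq_bigr => q qc.
    by rewrite (symtens_fixge _ ht) ?fixge_tperm.
  by rewrite !sumr_const !(card_ord_ltn cr).
have -> : (\sum_(q < r | (c < q)%N) f q : T) i = t i *+ (r - c.+1) +
    \sum_(q < r | (c < q)%N) \sum_(p < r | (p < c.+1)%N) t (permidx i (tperm p q)).
  rewrite sum_ffunE.
  under eq_bigr do rewrite tensD sum_ffunE.
  rewrite big_split /= sumr_const (card_ord_geq cr); congr (_ + _).
  by apply: eq_bigr => q _; apply: eq_bigr => p _; rewrite actE.
have -> : (\sum_(p < r | (c < p)%N) \sum_(q < r | (c < q)%N && (q != p)) (t + act p q) : T) i =
  \sum_(p < r | (c < p)%N) (\sum_(q < r | (c < q)%N) t (permidx i (tperm p q))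
     + (t i *+ (r - c.+1) - t i *+ 2)).
  rewrite sum_ffunE; apply: eq_bigr => p cp; rewrite sum_ffunE.
  rewrite -[X in _ *+ X - _](card_ord_geq cr) -sumr_const.
  rewrite [X in _ = X + _](bigD1 p) //= [X in _ = _ + (X - _)](bigD1 p) //= tperm1 permidx1.
  under eq_bigr do rewrite tensD actE.
  by rewrite big_split /= mulr2n; ring.
rewrite [in RHS]big_split /= sumr_const (card_ord_geq cr).
move: (r - c.+1)%N => d.
set S1 := \sum_(q < r | (c < q)%N) _; set S2 := \sum_(p < r | (c < p)%N) _.
rewrite !pmulrn !mulrzz !intS; ring.
Qed.

End SchurElements.

(** * The cyclic projective module D_a F (x) F^{(x) (r-a)} *)

Section Generator.
Variables n r : nat.
Local Notation I := (multiidx n.+1 r).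
Local Notation T := (tens n.+1 r).
Implicit Types (i j : I) (t u X : T) (p q l : 'I_r) (g h s : 'S_r) (a : nat).

(* The word 0^a 1 2 ... (r-a) indexing the highest weight generator of
   D_a F (x) F^{(x) (r-a)}: truncated subtraction sends the first a places to 0. *)
Definition hw a : I := [ffun p : 'I_r => inord (p.+1 - a)].

Lemma hwE a p : (r - a <= n)%N -> hw a p = (p.+1 - a)%N :> nat.
Proof.
move=> an; rewrite ffunE inordK // ltnS; apply: leq_trans an.
by apply: leq_sub2r.
Qed.

Lemma hw_eq a s s' : (r - a <= n)%N ->
  (permidx (hw a) s == permidx (hw a) s') = fixge a (s^-1 * s')%g.
Proof.
move=> an; apply/eqP/fixgeP => [e p ap|h].
  have /(congr1 (@nat_of_ord _)) := congr1 (fun f : I => f (s^-1%g p)) e.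
  rewrite [permidx _ s _]ffunE [permidx _ s' _]ffunE permKV !hwE // permM => e'.
  by apply/val_inj => /=; lia.
apply/ffunP=> p; apply: ord_inj; rewrite [permidx _ s p]ffunE [permidx _ s' p]ffunE !hwE //.
have E : s' p = (s^-1 * s')%g (s p) by rewrite permM permK.
have [ap|pa] := leqP a (s p); first by rewrite E h.
have : (s' p < a)%N; last by lia.
by rewrite E fixge_lt //; exact/fixgeP.
Qed.

Lemma hw_symtens a : (r - a <= n)%N -> ebas (hw a) \in symtens a.
Proof.
move=> an; apply: fixge_symtens => s i hs; rewrite !ffunE; congr (_%:R).
rewrite (can2_eq (permidxK s) (permidxKV s)); congr (nat_of_bool (_ == _)).
rewrite -[RHS]permidx1; apply/eqP; rewrite hw_eq // invgK mulg1.
exact: hs.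
Qed.

(** The equivariant matrix that sends [ebas (hw a)] to [t], with zero columns outside the orbit of
    [hw a]. When [t] is symmetric in the first [a] places, the permutation picked does not
    matter. *)
Definition sigma_fun a t : {ffun I * I -> int} :=
  [ffun ij => if [pick s | permidx (hw a) s == ij.2] is Some s
              then t (permidx ij.1 s^-1%g) else 0].

Lemma sigma_funE a t i s : (r - a <= n)%N -> t \in symtens a ->
  sigma_fun a t (i, permidx (hw a) s) = t (permidx i s^-1%g).
Proof.
move=> an ht; rewrite ffunE /=; case: pickP => [s'|/(_ s)]; last by rewrite eqxx.
rewrite eq_sym hw_eq // => hs.
by rewrite -(symtens_fixge _ ht hs) permidxM mulgK.
Qed.

Lemma sigma_fun_out a t i j : (forall s, permidx (hw a) s != j) -> sigma_fun a t (i, j) = 0.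
Proof. by move=> nj; rewrite ffunE /=; case: pickP => // s; rewrite (negbTE (nj s)). Qed.

Lemma hw_orbitP a j : (exists s, permidx (hw a) s = j) \/ (forall s, permidx (hw a) s != j).
Proof.
case: (pickP (fun s : 'S_r => permidx (hw a) s == j)) => [s /eqP e|no]; first by left; exists s.
by right=> s; rewrite no.
Qed.

Variables (a : nat) (an : (r - a <= n)%N).
Local Notation P := (lsub (@symtens n.+1 r a)).
Implicit Types (y : P).

Lemma sigma_subproof y : sigma_fun a (lsub_val y) \in @schur_pred n.+1 r.
Proof.
have hy := lsub_valP y; apply/schur_predP=> s i j; have [[s' <-]|nj] := hw_orbitP a j.
  by rewrite permidxM !sigma_funE // permidxM invMg mulgKV.
rewrite !sigma_fun_out // => s'; apply: contra (nj (s^-1 * s')%g) => /eqP e.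
by rewrite -permidxM e permidxK.
Qed.

Definition sigma y : schur n.+1 r := Defs.Schur (sigma_subproof y).

Lemma sigmaE y i s : sigma y (i, permidx (hw a) s) = lsub_val y (permidx i s^-1%g).
Proof. exact: sigma_funE an (lsub_valP y). Qed.

Lemma sigma_out y i j : (forall s, permidx (hw a) s != j) -> sigma y (i, j) = 0.
Proof. exact: sigma_fun_out. Qed.

Lemma sigma_linear A y y' : sigma (A *: y + y') = A * sigma y + sigma y'.
Proof.
apply: val_inj; apply/ffunP=> -[i j]; rewrite [RHS]ffunE.
have [[s <-]|nj] := hw_orbitP a j; last first.
  rewrite [LHS]sigma_fun_out // [X in _ = _ + X]sigma_fun_out // addr0 ffunE.
  by rewrite big1 // => k _; rewrite sigma_fun_out // mulr0.
rewrite [LHS]sigmaE [X in _ = _ + X]sigmaE linearP tensD tens_scaleE; congr (_ + _).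
rewrite ffunE (reindex_inj (bij_inj (permidx_bij n.+1 s^-1%g))) /=.
by apply: eq_bigr => k _; rewrite [sigma_fun _ _ _]sigmaE schur_inv.
Qed.

Definition gen : P := Lsub (hw_symtens an).

Lemma sigmaK y : sigma y *: gen = y.
Proof.
apply: val_inj; apply: tensP => i; rewrite /= scale_ebas.
by rewrite -{1}(permidx1 (hw a)) sigmaE invg1 permidx1.
Qed.

Lemma hom_sigma (W : lmodType (schur n.+1 r)) (f : P -> W) : linear f ->
  forall y, f y = sigma y *: f gen.
Proof.
move=> lf y.
have f0 : f 0 = 0 by have := lf (-1) 0 0; rewrite !scaleN1r oppr0 addr0 addNr.
by rewrite -{1}[y]sigmaK -[sigma y *: gen]addr0 lf f0 addr0.
Qed.

Lemma linear_sigma (W : lmodType (schur n.+1 r)) (w : W) : linear (fun y => sigma y *: w).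
Proof. by move=> A y y'; rewrite sigma_linear scalerDl scalerA. Qed.

End Generator.

(** * Parity of weight vectors *)

Section ZeroCount.
Variables r a mu : nat.
Hypotheses (amu : (a < mu)%N) (mur : (mu < r)%N).
Implicit Types (p q x y l : 'I_r) (g h s : 'S_r).

(* The number of places >= mu of the word [permidx (hw a) s] with letter 0. *)
Definition zeros s := #|[pred q : 'I_r | (mu <= q)%N && (s q < a)%N]|.

Lemma card_perm_ltn s c : (c <= r)%N -> #|[pred q : 'I_r | (s q < c)%N]| = c.
Proof.
move=> cr; rewrite -[RHS](card_ord_ltn cr) -!sum1_card [RHS](reindex_inj (@perm_inj _ s)) /=.
by apply: eq_bigl => q.
Qed.

(** The row, now the first [mu] places, holds a - 1 zeros, which leaves mu - a + 1 >= 2 other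
    letters because a < mu, that is, k >= 2. *)
Lemma zeros1_rows s : zeros s = 1%N ->
  exists x y, [/\ (x < mu)%N, (y < mu)%N, (a <= s x)%N, (a <= s y)%N & x != y].
Proof.
move=> z1; have ar : (a <= r)%N by lia.
pose A := [pred q : 'I_r | (q < mu)%N && (a <= s q)%N].
suff /card_gt1P[x [y [/andP[xm ax] /andP[ym ay] xy]]] : (1 < #|A|)%N by exists x, y.
have e1 := cardID [pred q : 'I_r | (q < mu)%N] [pred q : 'I_r | (s q < a)%N].
have e2 := cardID [pred q : 'I_r | (s q < a)%N] [pred q : 'I_r | (q < mu)%N].
rewrite card_perm_ltn // in e1; rewrite card_ord_ltn ?(ltnW mur) // in e2.
have e3 : #|[predD [pred q : 'I_r | (s q < a)%N] & [pred q : 'I_r | (q < mu)%N]]| = zeros s.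
  by apply: eq_card => q; rewrite !inE -leqNgt.
have e4 : #|[predD [pred q : 'I_r | (q < mu)%N] & [pred q : 'I_r | (s q < a)%N]]| = #|A|.
  by apply: eq_card => q; rewrite !inE -leqNgt andbC.
have e5 : #|[predI [pred q : 'I_r | (q < mu)%N] & [pred q : 'I_r | (s q < a)%N]]| =
   #|[predI [pred q : 'I_r | (s q < a)%N] & [pred q : 'I_r | (q < mu)%N]]|.
  by apply: eq_card => q; rewrite !inE andbC.
rewrite e3 z1 in e1; rewrite e4 e5 in e2.
by move: e1 e2; move: #|[predI _ & _]| #|A| => u v; lia.
Qed.

Lemma zeros_tperm s p q : (p < mu)%N -> (s p < a)%N -> (mu <= q)%N -> zeros s = 0%N ->
  zeros (tperm p q * s)%g = 1%N.
Proof.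
move=> pm pa mq z0; rewrite -(card1 q); apply: eq_card => x; rewrite !inE permM.
case: tpermP => [->|->|/eqP xp /eqP xq].
- by rewrite leqNgt pm /=; apply/esym/negbTE; apply: contraTneq mq => <-; rewrite -ltnNge.
- by rewrite mq pa eqxx.
- rewrite (negbTE xq); have /card0_eq/(_ x) := z0.
  by rewrite !inE.
Qed.

Lemma zeros_fixlt s g : fixlt a g -> zeros (s * g)%g = zeros s.
Proof.
move=> hg; apply: eq_card => q; rewrite !inE permM; congr (_ && _).
have [ga|ag] := ltnP (s q) a; first by rewrite (fixltP _ _ hg).
by rewrite ltnNge fixlt_ge.
Qed.

Lemma zeros_row_tperm s p q : (p < mu)%N = (q < mu)%N -> zeros (tperm p q * s)%g = zeros s.
Proof.
move=> pq; rewrite /zeros -!sum1_card (reindex_inj (@perm_inj _ (tperm p q))) /=.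
apply: eq_bigl => x; rewrite !inE permM tpermK; congr (_ && _).
have E : (mu <= p)%N = (mu <= q)%N by rewrite leqNgt pq -leqNgt.
by case: tpermP => // ->; rewrite E.
Qed.

(** [zeros] classifies the double cosets of two Young subgroups. Induction on the number of places
    where [s], but not [s'], has a zero: an exchange inside the row or inside the column removes one
    of them. Once the zeros are at the same places, [s'] is [s] times a permutation preserving the
    set of x < a. *)
Lemma double_coset_invariant (K : eqType) (f : 'S_r -> K) :
  (forall s p q, (p < mu)%N = (q < mu)%N -> f (tperm p q * s)%g = f s) ->
  (forall s p q, (p < a)%N = (q < a)%N -> f (s * tperm p q)%g = f s) ->
  forall s s', zeros s = zeros s' -> f s = f s'.
Proof.
move=> fl fr.
have frg g : (forall x, (g x < a)%N = (x < a)%N) -> forall s, f (s * g)%g = f s.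
  move: g; apply: (perm_class_ind (cls := fun x : 'I_r => (x < a)%N)) => [s|p q h pq _ IH s].
    by rewrite mulg1.
  by rewrite mulgA IH fr.
pose J s := [pred x | (s x < a)%N].
move=> s s'; have [N] := ubnP #|[predD J s & J s']|.
elim: N s => // N IH s sN z.
have ar : (a <= r)%N by lia.
have c1 := card_perm_ltn s ar; have c2 := card_perm_ltn s' ar.
case: (pickP [predD J s & J s']) => [p|d0]; last first.
  have JJ : J s =i J s'.
    have cJ : #|J s| = #|J s'| by rewrite c1 c2.
    apply/(subset_cardP cJ); apply/fintype.subsetP=> x xs.
    by have := d0 x; rewrite /= !inE in xs *; rewrite xs andbT => /negbFE.
  rewrite -[s'](mulKVg s) frg // => x.
  by rewrite permM -{2}(permKV s x); have := JJ (s^-1%g x); rewrite !inE.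
rewrite !inE => /andP[p' ps].
(* Row and column each hold as many zeros for [s] as for [s']; so the block of [p] has a place with
   a zero of [s'] only. *)
have [q /andP[qs' qs] pq] : exists2 q, (s' q < a)%N && (a <= s q)%N & (p < mu)%N = (q < mu)%N.
  case: (pickP [pred q | [&& (s' q < a)%N, (a <= s q)%N & (p < mu)%N == (q < mu)%N]]) => [q|D2].
    by move=> /and3P[h1 h2 /eqP h3]; exists q; rewrite ?h1.

    pose C := [pred x : 'I_r | (x < mu)%N == (p < mu)%N].
    suff cC : #|[predI C & J s]| = #|[predI C & J s']|.
      have sub : {subset [predI C & J s'] <= [predI C & J s]}.
        move=> x; rewrite !inE => /andP[xC xs']; rewrite xC /=.
        by have := D2 x; rewrite /= xs' eq_sym xC /= andbT ltnNge => ->.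
      have /subset_cardP : #|[predI C & J s']| = #|[predI C & J s]| by rewrite cC.
      move=> /(_ (introT fintype.subsetP sub)) /(_ p); rewrite !inE eqxx ps /=.
      by rewrite (negbTE p').
    have h t : (#|[predI [pred x : 'I_r | (x < mu)%N] & J t]| + zeros t = a)%N.
      rewrite -[RHS](card_perm_ltn t ar) -(cardID [pred x : 'I_r | (x < mu)%N] (J t)).
      congr (_ + _)%N; apply: eq_card => x; rewrite !inE 1?andbC //.
      by rewrite -leqNgt andbC.
    have h1 := h s; have h2 := h s'.
    case pm: (p < mu)%N in C D2 *.
      transitivity #|[predI [pred x : 'I_r | (x < mu)%N] & J s]|.
        by apply: eq_card => x; rewrite !inE eqb_id.
      transitivity #|[predI [pred x : 'I_r | (x < mu)%N] & J s']|; first lia.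
      by apply: eq_card => x; rewrite !inE eqb_id.
    transitivity (zeros s); first by apply: eq_card => x; rewrite !inE eqbF_neg -leqNgt.
    by rewrite z; apply: eq_card => x; rewrite !inE eqbF_neg -leqNgt.
rewrite -(fl s p q pq); apply: IH; last by rewrite zeros_row_tperm.
rewrite -ltnS; apply: leq_trans sN; rewrite ltnS; apply: proper_card.
apply/properP; split; last first.
  exists p; first by rewrite !inE p' ps.
  by rewrite !inE permM tpermL p' /= -leqNgt.
apply/fintype.subsetP=> x; rewrite !inE permM; case: tpermP => [->|->|//].
  by rewrite [(s q < a)%N]ltnNge qs andbF.
by rewrite qs'.
Qed.

End ZeroCount.

(** An orbit of two elements contributes 2 F(j) + (F(phi j) - F(j)). *)
Lemma sum_involution_even (J : finType) (F : J -> int) (phi : J -> J) : involutive phi ->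
  (forall j, (2 %| F (phi j) - F j)%Z) -> (forall j, phi j = j -> (2 %| F j)%Z) ->
  (2 %| \sum_j F j)%Z.
Proof.
move=> phiK hphi hfix; pose rk (j : J) : nat := enum_rank j.
rewrite (bigID (fun j => (rk j < rk (phi j))%N)) /=.
rewrite [X in _ + X](bigID (fun j => phi j == j)) /= addrCA rpredD //.
  by apply: rpred_sum => j /andP[_ /eqP]; exact: hfix.
rewrite [X in _ + X](reindex_inj (inv_inj phiK)) /=.
have -> : \sum_(j | ~~ (rk (phi j) < rk (phi (phi j)))%N && (phi (phi j) != phi j)) F (phi j) =
    \sum_(j | (rk j < rk (phi j))%N) F (phi j).
  apply: eq_bigl => j; rewrite phiK -leqNgt leq_eqVlt andb_orl eq_sym.
  have -> : (rk (phi j) == rk j :> nat) = (phi j == j).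
    by apply/eqP/eqP => [/ord_inj/enum_rank_inj|->].
  by case: eqVneq => [->|]; rewrite ?ltnn ?andbF ?andbT.
rewrite -big_split /=; apply: rpred_sum => j _.
rewrite -[F (phi j)](subrK (F j)) addrCA rpredD //.
by rewrite -mulr2n pmulrn mulrzz; exact: dvdz_mull.
Qed.

(** * Coefficients at the rearrangements of [hw a] *)

Section WeylWords.
Variables n r a mu : nat.
Hypotheses (a0 : (0 < a)%N) (amu : (a < mu)%N) (mur : (mu < r)%N) (an : (r - a <= n)%N).
Local Notation I := (multiidx n.+1 r).
Local Notation T := (tens n.+1 r).
Implicit Types (i j : I) (t u X : T) (p q l : 'I_r) (g h s : 'S_r) (d : int).
Local Notation wd s := (permidx (hw n r a) s).
Local Notation zeros := (zeros a mu).

Lemma a_lt_r : (a < r)%N. Proof. exact: ltn_trans amu mur. Qed.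

Lemma wd_fixge s g : fixge a g -> wd (s * g)%g = wd s.
Proof. by move=> hg; apply/esym/eqP; rewrite hw_eq // mulKg. Qed.

Lemma wd_row s x y : wd (tperm x y * s)%g = permidx (wd s) (tperm x y).
Proof. by rewrite permidxM. Qed.

Lemma wd_zero s p q : (s p < a)%N -> (s q < a)%N -> wd s p = wd s q.
Proof.
move=> pa qa; apply: ord_inj; rewrite [permidx _ s p]ffunE [permidx _ s q]ffunE !hwE //.
clear a0 amu mur; lia.
Qed.

Lemma wd_inj s p q : (a <= s p)%N || (a <= s q)%N -> wd s p = wd s q -> p = q.
Proof.
move=> apq /(congr1 (@nat_of_ord _)).
rewrite [permidx _ s p]ffunE [permidx _ s q]ffunE !hwE // => e.
by apply: (@perm_inj _ s); apply: ord_inj; clear a0 amu mur; lia.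
Qed.

Lemma weyl_zeros2 X s : weyl mu X -> (1 < zeros s)%N -> X (wd s) = 0.
Proof.
move=> [_ ha _] /card_gt1P[q [q' [/andP[mq sq] /andP[mq' sq'] qq']]].
by apply: (antisym_repeat ha mq mq' qq'); apply: wd_zero.
Qed.

Lemma weyl_zeros0 X s : weyl mu X -> zeros s = 0%N -> exists2 p : 'I_r, (p < mu)%N && (s p < a)%N &
  X (wd s) = \sum_(q < r | (mu <= q)%N) X (wd (tperm p q * s)%g).
Proof.
move=> [_ _ hg] z0; pose o := Ordinal (ltn_trans a0 a_lt_r).
have pm : (s^-1%g o < mu)%N.
  rewrite ltnNge; apply/negP => h; have /card0_eq/(_ (s^-1%g o)) := z0.
  by rewrite !inE h permKV /= a0.
exists (s^-1%g o); first by rewrite pm permKV.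
by rewrite (hg _ _ pm); apply: eq_bigr => q _; rewrite wd_row.
Qed.

(** Two zeros in the column force the coefficient 0. With none there, the relation at a row place
    carrying a zero expresses the coefficient through words with exactly one zero in the column. *)
Lemma weyl_dvd d X : weyl mu X -> (forall s, zeros s = 1%N -> (d %| X (wd s))%Z) ->
  forall s, (d %| X (wd s))%Z.
Proof.
move=> hX h1 s; case z: (zeros s) => [|[|m]]; last by rewrite weyl_zeros2 ?z ?dvdz0.
  have [p /andP[pm pa] ->] := weyl_zeros0 hX z.
  by apply: rpred_sum => q mq; apply/h1/zeros_tperm.
exact: h1.
Qed.

(* The parity of the coefficient at a word with [m] zeros in the column, when
   all the coefficients with [m = 1] are odd. *)
Definition kappa (m : nat) : int := if m is 0%N then (r - mu)%N else (m == 1%N).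

Lemma weyl_parity X : weyl mu X -> (forall s, zeros s = 1%N -> (2 %| X (wd s) - 1)%Z) ->
  forall s, (2 %| X (wd s) - kappa (zeros s))%Z.
Proof.
move=> hX h1 s; case z: (zeros s) => [|[|m]]; last by rewrite weyl_zeros2 ?z ?subrr ?dvdz0.
  have [p /andP[pm pa] ->] := weyl_zeros0 hX z.
  rewrite /kappa -(card_ord_geq (ltnW mur)) -natz -sumr_const -sumrB.
  by apply: rpred_sum => q mq; apply/h1/zeros_tperm.
exact: h1.
Qed.

Lemma weyl_odd_exists :
  exists2 X, weyl mu X & forall s, zeros s = 1%N -> (2 %| X (wd s) - 1)%Z.
Proof.
(* Alternating this indicator gives 1 or -1 at rearrangements of [hw a] with distinct column
   letters. If one column letter is zero, a smallest letter is in the column, so [col_extension]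
   preserves the coefficient. *)
pose ind : T := [ffun i => ([exists s, wd s == i] && sorted_from mu i)%:R].
have h_ind : ind \in symtens mu.
  apply: fixge_symtens => s i hs; rewrite !ffunE; congr (nat_of_bool (_ && _))%:R.
    apply/existsP/existsP => -[s' /eqP e].
      by exists (s^-1 * s')%g; rewrite -permidxM e permidxK.
    by exists (s * s')%g; rewrite -permidxM e.
  have fs (x : 'I_r) : (mu <= x)%N -> s x = x by move/(fixgeP _ _ hs).
  apply/sorted_fromP/sorted_fromP => si p q mp pq; have := si _ _ mp pq;
      by rewrite !ffunE !fs // (leq_trans mp) // ltnW.
have [t ht tE] := col_extension mur (symtens_alt (leqnn _) h_ind) (@alt_antisym _ _ mu ind).
exists (alt mu t); first by apply: weyl_alt => //; apply: ltn_trans amu.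
move=> s z1; have /card_gt0P[q /andP[mq sq]] : (0 < zeros s)%N by rewrite z1.
rewrite (tE _ q) //; last first.
  apply/minatP=> x; rewrite [permidx _ s q]ffunE hwE //.
  by rewrite (_ : (s q).+1 - a = 0)%N //; lia.
have [|g hg sg] := @sorting_perm _ _ mu (wd s).
  move=> x y mx my; have [ax|xa] := leqP a (s x); first by apply: wd_inj; rewrite ax.
  have [ay|ya] := leqP a (s y); first by apply: wd_inj; rewrite ay orbT.
  move=> _; apply/eqP; apply: contraT => xy.
  suff : (1 < zeros s)%N by rewrite z1.
  by apply/card_gt1P; exists x, y; rewrite !inE mx my xa ya.
have -> : alt mu ind (wd s) = (-1) ^+ g * alt mu ind (permidx (wd s) g).
  by rewrite (@alt_antisym _ _ mu ind g (wd s)) // signM1.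
rewrite alt_sorted => [|g' hg' g1]; last first.
  rewrite ffunE; case: andP => // -[_ sg']; case/eqP: g1.
  exact: sorted_from_unique sg hg' sg'.
rewrite ffunE sg andbT (_ : [exists _, _]); first by case: odd_perm.
by apply/existsP; exists (g * s)%g; rewrite permidxM.
Qed.

Local Notation wd' s := (permidx (hw n r a.+1) s).
Let an1 : (r - a.+1 <= n)%N. Proof. exact: leq_trans (leq_sub2l _ (leqnSn a)) an. Qed.

(** [y] is the generator of D_(a+1) F (x) F^{(x) (r-a-1)}. The sum runs over the words in which one
    of its a + 1 zeros becomes the letter 1, the nonzero letters being raised by one. *)
Lemma sigma_omega (y : lsub (@symtens n.+1 r a)) X s0 : lsub_val y = ebas (hw n r a.+1) ->
  (sigma an y *: X) (wd' s0) =
    \sum_(l < r | (l <= a)%N) X (wd (s0 * tperm l (Ordinal a_lt_r))%g).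
Proof.
move=> yE; set pa := Ordinal a_lt_r; pose A := [set l : 'I_r | (l <= a)%N].
pose h l := wd (s0 * tperm l pa)%g.
have sE s : sigma an y (wd' s0, wd s) = (fixge a.+1 (s0^-1 * s)%g)%:R.
  rewrite sigmaE yE ffunE permidxM -[X in _ == X]permidx1 hw_eq // mulg1 invMg invgK.
  by [].
rewrite tens_scaleE (bigID (mem (h @: A))) /= [X in _ + X]big1 ?addr0 => [|j jA]; last first.
  have [[s sj]|nj] := hw_orbitP a j; last by rewrite sigma_out // mul0r.
  rewrite -sj sE; case: (boolP (fixge _ _)) => [hf|_]; last by rewrite mul0r.
  case/negP: jA; set g := (s0^-1 * s)%g in hf *.
  have gE : s = (s0 * g)%g by rewrite /g mulKVg.
  have la : (g^-1%g pa <= a)%N.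
    rewrite leqNgt; apply/negP => al; have := fixgeP _ _ hf _ al.
    by rewrite permKV => e; rewrite -e ltnn in al.
  apply/imsetP; exists (g^-1%g pa); first by rewrite inE.
  rewrite -sj gE /h; apply/esym/eqP; rewrite hw_eq // invMg tpermV -!mulgA mulKg.
  apply/fixgeP=> p; rewrite leq_eqVlt permM => /orP[/eqP e|ap].
    have -> : p = pa by apply: ord_inj.
    by rewrite tpermR permKV.
  rewrite tpermD ?(fixgeP _ _ hf) //; first by apply: contraTneq ap => <-; rewrite -leqNgt.
  by apply: contraTneq ap => <-; rewrite ltnn.
rewrite big_imset /=; last first.
  move=> l l' _ _ /eqP; rewrite hw_eq // invMg tpermV -!mulgA mulKg => /fixgeP/(_ pa (leqnn a)).
  by rewrite permM tpermR => e; apply: (@perm_inj _ (tperm l' pa)); rewrite e tpermL.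
apply: eq_big => [l|l]; rewrite inE // => la.
rewrite /h sE mulKg fixge_tperm ?mul1r //.
Qed.

Lemma sigma_omega_out (y : lsub (@symtens n.+1 r a)) X i : lsub_val y = ebas (hw n r a.+1) ->
  (forall s, wd' s != i) -> (sigma an y *: X) i = 0.
Proof.
move=> yE ni; rewrite tens_scaleE big1 // => j _.
have [[s sj]|nj] := hw_orbitP a j; last by rewrite sigma_out // mul0r.
rewrite -sj sigmaE yE ffunE; case: eqP => [e|_]; last by rewrite mul0r.
by have := ni s; rewrite -e permidxKV eqxx.
Qed.

Definition zeros1 s := #|[pred q : 'I_r | (mu <= q)%N && (s q <= a)%N]|.

Lemma zeros1E s l : (l <= a)%N ->
  zeros1 s = ((mu <= s^-1%g l)%N + zeros (s * tperm l (Ordinal a_lt_r))%g)%N.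
Proof.
move=> la; rewrite /zeros1 (cardD1 (s^-1%g l)) !inE permKV la andbT; congr (_ + _)%N.
apply: eq_card => q; rewrite !inE permM -(can2_eq (permK s) (permKV s)).
rewrite andbCA; congr (_ && _); case: tpermP => [->|->|/eqP ql /eqP qa].
- by rewrite eqxx /= ltnn.
- rewrite leqnn andbT ltn_neqAle la andbT; congr negb.
  by rewrite eq_sym; apply/eqP/eqP => [-> //|e]; apply: ord_inj.
- rewrite ql /= leq_eqVlt; case: eqP => // e.
  by case/eqP: qa; apply: ord_inj.
Qed.

(** If z of the a + 1 zeros are in the column, then z of the terms lose a column zero and the other
    a + 1 - z keep them all. *)
Lemma omega_parity X s0 : (forall s, (2 %| X (wd s) - kappa (zeros s))%Z) ->
  (2 %| \sum_(l < r | (l <= a)%N) X (wd (s0 * tperm l (Ordinal a_lt_r))%g) -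
    (kappa (zeros1 s0).-1 *+ zeros1 s0 + kappa (zeros1 s0) *+ (a.+1 - zeros1 s0)))%Z.
Proof.
move=> hX; set z := zeros1 s0.
have <- : \sum_(l < r | (l <= a)%N) kappa (zeros (s0 * tperm l (Ordinal a_lt_r))%g) =
    kappa z.-1 *+ z + kappa z *+ (a.+1 - z).
  have c1 : #|[pred l : 'I_r | (l <= a)%N && (mu <= s0^-1%g l)%N]| = z.
    rewrite /z /zeros1 -!sum1_card [LHS](reindex_inj (@perm_inj _ s0)) /=.
    by apply: eq_bigl => q; rewrite !inE permK andbC.
  have c2 : #|[pred l : 'I_r | (l <= a)%N && ~~ (mu <= s0^-1%g l)%N]| = (a.+1 - z)%N.
    rewrite -(card_ord_ltn a_lt_r) -c1.
    rewrite -(cardID [pred l : 'I_r | (mu <= s0^-1%g l)%N] [pred l : 'I_r | (l < a.+1)%N]).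
    rewrite addnC [X in (_ - X)%N](_ : _ =
      #|[predI [pred l : 'I_r | (l < a.+1)%N] & [pred l : 'I_r | (mu <= s0^-1%g l)%N]]|).
      by rewrite addnK; apply: eq_card => l; rewrite !inE andbC.
    by apply: eq_card => l; rewrite !inE andbC.
  rewrite (bigID (fun l => (mu <= s0^-1%g l)%N)) /= -[X in _ *+ X + _]c1 -[X in _ + _ *+ X]c2.
  rewrite -!sumr_const; congr (_ + _); apply: eq_bigr => l /andP[la lm].
    by rewrite /z (zeros1E s0 la) lm.
  by rewrite /z (zeros1E s0 la) (negbTE lm).
by rewrite -sumrB; apply: rpred_sum => l _; exact: hX.
Qed.

End WeylWords.

(** * Homomorphisms on the kernel *)

Section ExtComputation.
Variables n r a mu : nat.
Hypotheses (a0 : (0 < a)%N) (amu : (a < mu)%N) (mur : (mu < r)%N) (an : (r - a <= n)%N).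
Local Notation I := (multiidx n.+1 r).
Local Notation T := (tens n.+1 r).
Local Notation S := (schur n.+1 r).
Local Notation P := (lsub (@symtens n.+1 r a)).
Implicit Types (i j : I) (t u X : T) (p q l : 'I_r) (g h s : 'S_r) (y v : P).
Local Notation wd s := (permidx (hw n r a) s).
Local Notation zeros := (zeros a mu).
Local Notation sigma := (sigma an).
Local Notation gen := (gen an).

Lemma sact_linear g : linear (@sact n.+1 r g).
Proof.
move=> A t u; apply: tensP => i; rewrite tensD tens_scaleE !sactE tensD mulrDr.
congr (_ + _); rewrite tens_scaleE mulr_sumr.
rewrite (reindex (fun k => permidx k g)) /=; last exact/onW_bij/(permidx_bij n.+1 g).
by apply: eq_bigr => j _; rewrite schur_inv sactE mulrCA.
Qed.

(** The weight space of weight (a, 1^(r-a)); [sigma gen] acts as the projection onto it. *)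
Definition supported X := forall i, (forall s, wd s != i) -> X i = 0.

Lemma sigma_gen_wd X s : (sigma gen *: X) (wd s) = X (wd s).
Proof.
rewrite tens_scaleE (bigD1 (wd s)) // sigmaE ffunE permidxK eqxx mul1r.
rewrite big1 => [|j js]; first exact: addr0.
have [[s' e]|nj] := hw_orbitP a j; last first.
  by rewrite sigma_out // mul0r.
rewrite -e sigmaE ffunE; case: eqP => [e'|_]; last by rewrite mul0r.
have e2 : wd s' = wd s by rewrite -[RHS](permidxKV s') e'.
by rewrite -e e2 eqxx in js.
Qed.

Lemma sigma_gen_supported X : supported (sigma gen *: X).
Proof.
move=> i ni; rewrite tens_scaleE big1 // => j _.
have [[s' e]|nj] := hw_orbitP a j; last by rewrite sigma_out // mul0r.
rewrite -e sigmaE ffunE; case: eqP => [e'|_]; last by rewrite mul0r.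
by have := ni s'; rewrite -e' permidxKV eqxx.
Qed.

Definition up t : P := insubd 0 t.

Lemma upK t : t \in symtens a -> lsub_val (up t) = t.
Proof. by move=> ht; exact: insubdK. Qed.

Lemma upD (A : S) t u : t \in symtens a -> u \in symtens a -> up (A *: t + u) = A *: up t + up u.
Proof.
move=> ht hu; apply: val_inj; rewrite [RHS](linearP (@lsub_val _ _ _)) /= !upK //.
by rewrite rpredD // rpredZ.
Qed.

Lemma letters_hw p q x : (a <= p)%N -> (a <= q)%N -> p != q ->
  tperm (hw n r a p) (hw n r a q) (hw n r a x) = hw n r a (tperm p q x).
Proof.
move=> ap aq pq; have hw_inj (z z' : 'I_r) : (a <= z)%N -> hw n r a z = hw n r a z' -> z = z'.
  move=> az e; have := @wd_inj _ _ _ an 1%g z z'; rewrite !permidx1 perm1 az; exact.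
have [->|xp] := eqVneq x p; first by rewrite !tpermL.
have [->|xq] := eqVneq x q; first by rewrite !tpermR.
rewrite [tperm p q x]tpermD 1?eq_sym // tpermD //.
  by apply: contra xp => /eqP/hw_inj ->.
by apply: contra xq => /eqP/hw_inj ->.
Qed.

Definition swap_gen p q : P := up (lsub_val gen - sact (tperm p q) (lsub_val gen)).

(** On the generator, exchanging two places from [a] on amounts to exchanging their letters, which
    an element of the Schur algebra does. Hence [swap_gen p q] is the generator plus its image under
    that letter exchange. *)
Lemma sigma_swap_gen X s p q : (a <= p)%N -> (a <= q)%N -> p != q ->
  (sigma (swap_gen p q) *: X) (wd s) = X (wd s) + X (wd (s * tperm p q)%g).
Proof.
move=> ap aq pq; pose pi := tperm (hw n r a p) (hw n r a q).
have wdpi s' : letters pi (wd (s' * tperm p q)%g) = wd s'.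
  apply/ffunP=> x; rewrite ffunE [permidx _ _ x]ffunE [RHS]ffunE letters_hw //.
  by rewrite permM tpermK.
have -> : swap_gen p q = letp r pi *: gen + gen.
  apply: val_inj; rewrite [RHS](linearP (@lsub_val _ _ _)) /swap_gen /= upK; last first.
    by rewrite rpredB ?symtens_sact ?fixlt_tperm ?hw_symtens.
  rewrite addrC; congr (_ + _); apply: tensP => i.
  rewrite tensN sactE odd_tperm pq expr1 mulN1r opprK scale_ebas ffunE [RHS]ffunE /=.
  have -> : letters pi (hw n r a) = wd (tperm p q).
    by apply/ffunP=> x; rewrite ffunE [RHS]ffunE letters_hw.
  congr (nat_of_bool _)%:R; apply/eqP/eqP => [<-|->];
    by rewrite permidxM tperm2 permidx1.
rewrite sigma_linear scalerDl tensD addrC; congr (_ + _); first exact: sigma_gen_wd.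
by rewrite -scalerA -{1}(wdpi s) letp_scale sigma_gen_wd.
Qed.

Lemma weyl_divz X (d : int) : d != 0 -> weyl mu (X *~ d) -> weyl mu X.
Proof.
move=> d0 [hs ha hg]; have cd (x z : int) : x * d = z * d -> x = z by apply: mulIf.
have XE i : (X *~ d) i = X i * d by rewrite ffunMzE mulrzz.
split.
- by apply: fixge_symtens => s i hs'; apply: cd; rewrite -!XE (symtens_fixge _ hs).
- by move=> g i hgg; apply: cd; rewrite -mulrA -!XE ha.
- move=> p i pm; apply: cd; rewrite -XE (hg p) // mulr_suml.
  by apply: eq_bigr => q _; rewrite XE.
Qed.

Lemma weyl_divisible X (d : int) : d != 0 -> weyl mu X -> supported X ->
  (forall s, zeros s = 1%N -> (d %| X (wd s))%Z) ->
  exists X', [/\ weyl mu X', supported X' & X = X' *~ d].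
Proof.
move=> d0 hX sX h1; have hd := weyl_dvd a0 amu mur an hX h1.
pose X' : T := [ffun i => (X i %/ d)%Z].
have XE : X = X' *~ d.
  apply: tensP => i; rewrite ffunMzE ffunE mulrzz.
  have [[s <-]|ni] := hw_orbitP a i; first by rewrite divzK.
  by rewrite sX // div0z mul0r.
exists X'; split=> //; first by apply: (weyl_divz d0); rewrite -XE.
by move=> i ni; rewrite ffunE sX // div0z.
Qed.

Lemma weylB X X' : weyl mu X -> weyl mu X' -> weyl mu (X - X').
Proof.
move=> [hs ha hg] [hs' ha' hg']; split; first by rewrite rpredB.
  by move=> g i hgg; rewrite !tensD !tensN ha // ha' // mulrDr mulrN.
move=> p i pm; rewrite tensD tensN (hg p) // (hg' p) // -sumrB.
by apply: eq_bigr => q _; rewrite tensD tensN.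
Qed.

Lemma tens_torsionfree t (d : int) : d != 0 -> t *~ d = 0 -> t = 0.
Proof.
move=> d0 td; apply: tensP => i; rewrite [RHS]ffunE.
have : (t *~ d) i = 0 by rewrite td ffunE.
by rewrite ffunMzE mulrzz => /eqP; rewrite mulf_eq0 (negbTE d0) orbF => /eqP.
Qed.

(** M and N stand for Delta(h) and Delta(h(k)), with mu = a + k - 1; they are known through a
    presentation of M and an embedding of N. *)
Variables (M N : lmodType S) (pi : {linear P -> M}) (iota : {linear N -> T}).
Hypothesis piP : forall y, pi y = 0 <->
  exists2 u, u \in symtens a.+1 & lsub_val y - u \in alttens a.
Hypotheses (iota_inj : injective iota) (iota_weyl : forall x, weyl mu (iota x)).
Hypothesis iota_surj : forall t, weyl mu t -> exists x, iota x = t.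

Lemma pi_alttens y : lsub_val y \in alttens a -> pi y = 0.
Proof. by move=> hy; apply/piP; exists 0; rewrite ?rpred0 ?subr0. Qed.

Lemma pi_symtens y : lsub_val y \in symtens a.+1 -> pi y = 0.
Proof. by move=> hy; apply/piP; exists (lsub_val y); rewrite // subrr rpred0. Qed.

Lemma ker_decomp y : pi y = 0 -> exists y1 y2, [/\ y = y1 + y2,
  lsub_val y1 \in alttens a & lsub_val y2 \in symtens a.+1].
Proof.
move=> /piP[u hu yu]; have hua := symtensS hu.
have E : lsub_val (y - up u) = lsub_val y - u by rewrite linearB /= upK.
by exists (y - up u), (up u); rewrite subrK E upK.
Qed.

Lemma pi_swap_gen p q : (a <= p)%N -> (a <= q)%N -> pi (swap_gen p q) = 0.
Proof.
move=> ap aq; have hg : fixlt a (tperm p q) by exact: fixlt_tperm.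
apply: pi_alttens; rewrite upK ?sub_sact_alttens ?hw_symtens //.
by rewrite rpredB ?symtens_sact ?hw_symtens.
Qed.

Section KLinear.
Variable H : P -> N.
Hypothesis HK : klinear pi H.

Lemma klinear0 : H 0 = 0.
Proof.
by have := HK (-1) (linear0 pi) (linear0 pi); rewrite !scaleN1r oppr0 addr0 addNr.
Qed.

Lemma klinearD y v : pi y = 0 -> pi v = 0 -> H (y + v) = H y + H v.
Proof. by move=> hy hv; have := HK 1 hy hv; rewrite !scale1r. Qed.

Lemma klinearB y v : pi y = 0 -> pi v = 0 -> H (y - v) = H y - H v.
Proof.
by move=> hy hv; have := HK (-1) hv hy; rewrite !scaleN1r ![- _ + _]addrC.
Qed.

Lemma klinear_sum (J : finType) (Q : pred J) (F : J -> P) :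
  (forall x, Q x -> pi (F x) = 0) -> H (\sum_(x | Q x) F x) = \sum_(x | Q x) H (F x).
Proof.
move=> hF; suff [] : pi (\sum_(x | Q x) F x) = 0 /\
  H (\sum_(x | Q x) F x) = \sum_(x | Q x) H (F x) by [].
elim/big_rec2: _ => [|x y v Qx [hv hy]]; first by rewrite linear0 klinear0.
by rewrite linearD /= hF // hv addr0 klinearD ?hF // hy.
Qed.

Definition sym_extension y : N :=
  \sum_(g | fixlt a g) H (up (lsub_val y - sact g (lsub_val y))).

Lemma sub_sact_symtens g y : fixlt a g -> lsub_val y - sact g (lsub_val y) \in symtens a.
Proof. by move=> hg; rewrite rpredB ?symtens_sact ?lsub_valP. Qed.

Lemma pi_sub_sact g y : fixlt a g -> pi (up (lsub_val y - sact g (lsub_val y))) = 0.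
Proof.
move=> hg; apply: pi_alttens; rewrite upK ?sub_sact_symtens //.
exact: sub_sact_alttens (lsub_valP y).
Qed.

Lemma sym_extension_linear : linear sym_extension.
Proof.
move=> A y v; rewrite /sym_extension scaler_sumr -big_split /=; apply: eq_bigr => g hg.
rewrite -HK ?pi_sub_sact // -upD ?sub_sact_symtens //; congr (H (up _)).
rewrite sact_linear.
by rewrite opprD addrACA -scalerBr.
Qed.

(** For such [y] each term splits as H(y) minus H of a signed translate of [y], and the signed
    translates add up to [alt a y], which is zero. *)
Lemma sym_extension_alttens y : lsub_val y \in alttens a ->
  sym_extension y = H y *+ #|[pred g : 'S_r | fixlt a g]|.
Proof.
move=> hy; have hy' := lsub_valP y.
have pis g : fixlt a g -> pi (up (sact g (lsub_val y))) = 0.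
  move=> hg; apply: pi_alttens; rewrite upK ?symtens_sact //.
  by rewrite -[sact _ _](subKr (lsub_val y)) rpredB ?sub_sact_alttens.
transitivity (\sum_(g | fixlt a g) (H y - H (up (sact g (lsub_val y))))).
  apply: eq_bigr => g hg; rewrite -klinearB ?pis ?pi_alttens //; congr H.
  apply: val_inj; rewrite [RHS](linearB (@lsub_val _ _ _)) /= !upK ?symtens_sact //.
  exact: sub_sact_symtens.
have Z : \sum_(g | fixlt a g) up (sact g (lsub_val y)) = 0.
  apply: val_inj; transitivity (\sum_(g | fixlt a g) sact g (lsub_val y)).
    rewrite [LHS](linear_sum (@lsub_val _ _ _)); apply: eq_bigr => g hg.
    by apply: upK; rewrite symtens_sact.
  rewrite -[RHS](alt_alttens hy); apply: tensP => i; rewrite sum_ffunE altE.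
  by apply: eq_bigr => g _; rewrite sactE.
by rewrite sumrB sumr_const -klinear_sum // Z klinear0 subr0.
Qed.

Let G := #|[pred g : 'S_r | fixlt a g]|.

(* The Casimir element acts on Delta(a+1, 1^(r-a-1)) and on Delta(mu+1, 1^(r-mu-1))
   by the distinct scalars c1 and c2, so the difference D of both sides is zero. *)
Lemma sym_extension_symtens y : lsub_val y \in symtens a.+1 -> sym_extension y = H y *+ G.
Proof.
move=> hy; pose D v := sym_extension v - H v *+ G.
have Dlin (A : S) v w : pi v = 0 -> pi w = 0 -> D (A *: v + w) = A *: D v + D w.
  move=> hv hw; rewrite /D sym_extension_linear HK // mulrnDl scalerBr scalerMnr.
  by rewrite opprD addrACA.
have D0 : D 0 = 0.
  by have := Dlin (-1) 0 0 (linear0 pi) (linear0 pi); rewrite !scaleN1r oppr0 addr0 addNr.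
have DZ (A : S) v : pi v = 0 -> D (A *: v) = A *: D v.
  by move=> hv; rewrite -[A *: v]addr0 Dlin ?linear0 // D0 addr0.
pose c1 : int := a.+1%:Z ^+ 2 - (r - a.+1)%N%:Z ^+ 2.
pose c2 : int := mu.+1%:Z ^+ 2 - (r - mu.+1)%N%:Z ^+ 2.
have py := pi_symtens hy.
have hcas : lsub_val (casimir n.+1 r *: y - c1%:~R *: y) \in alttens a.
  have -> : lsub_val (casimir n.+1 r *: y - c1%:~R *: y) =
      casimir n.+1 r *: lsub_val y - lsub_val y *~ c1.
    by rewrite -scaler_int linearB !linearZ.
  exact: casimir_alttens (a_lt_r amu mur) hy.
have Z : D (casimir n.+1 r *: y - c1%:~R *: y) = 0.
  by rewrite /D sym_extension_alttens // subrr.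
have Dc1 : D (casimir n.+1 r *: y) = D y *~ c1.
  rewrite -[casimir _ _ *: y](subrK (c1%:~R *: y)) -[X in D (X + _)]scale1r Dlin.
  - by rewrite Z DZ // scaler_int scaler0 add0r.
  - exact: pi_alttens.
  - by rewrite linearZ /= py scaler0.
have : iota (D y) *~ c2 = iota (D y) *~ c1.
  rewrite -(casimir_weyl mur (iota_weyl (D y))) -linearZ /= -DZ // Dc1.
  by rewrite raddfMz.
move=> /eqP; rewrite -subr_eq0 -mulrzBr => /eqP/tens_torsionfree h.
apply/eqP; rewrite -subr_eq0; apply/eqP; apply: iota_inj; rewrite linear0; apply: h.
(* The difference [c2 - c1] equals 2r(mu - a). *)
by rewrite /c1 /c2; move: amu mur => ? ?; nia.
Qed.
Lemma sym_extensionE y : pi y = 0 -> sym_extension y = H y *+ G.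
Proof.
move=> /ker_decomp[y1 [y2 [-> h1 h2]]].
rewrite -[y1 in LHS]scale1r sym_extension_linear scale1r.
rewrite sym_extension_alttens // sym_extension_symtens // -mulrnDl.
by rewrite (klinearD (pi_alttens h1) (pi_symtens h2)).
Qed.

Lemma card_fixlt : G = (r - a)`!.
Proof.
have ar := a_lt_r amu mur.
have <- : #|[set x : 'I_r | (a <= x)%N]| = (r - a)%N.
  by rewrite cardsE card_ord_geq // ltnW.
rewrite -card_perm; apply: eq_card => g; rewrite !inE.
apply/fixltP/fintype.subsetP => h x; rewrite ?inE.
  by apply: contraNT; rewrite -ltnNge => /h ->.
by move=> xa; apply/eqP; apply: contraLR xa => /h; rewrite inE -leqNgt.
Qed.

Lemma klinear_half : exists X, [/\ weyl mu X, supported X &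
  forall y, pi y = 0 -> iota (H y) *~ 2 = sigma y *: X].
Proof.
pose X0 := iota (sym_extension gen).
have YE y : iota (sym_extension y) = sigma y *: X0.
  by rewrite (hom_sigma an sym_extension_linear y) linearZ.
have [G' GE G0] : exists2 G', G = (G' * 2)%N & (0 < G')%N.
  have /dvdnP[G' GE] : (2 %| G)%N by rewrite card_fixlt dvdn_fact //; lia.
  by exists G' => //; have := fact_gt0 (r - a); rewrite -card_fixlt GE; case: (G').
have G0' : G'%:Z != 0 by case: (G') G0.
have [||X' [wX' sX' XE]] := weyl_divisible G0' (iota_weyl (sym_extension gen)).
- by rewrite YE; exact: sigma_gen_supported.
(* Exchange the nonzero letters at two row places. Row symmetry leaves the coefficient of [X0]
   unchanged, so the relation reads 2 X0 = 2 G' z at this word. *)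
- move=> s /(zeros1_rows amu mur)[x [y [xm ym ax ay xy]]].
  have sxy : s x != s y by apply: contra xy => /eqP/perm_inj ->.
  have := sigma_swap_gen X0 s ax ay sxy.
  rewrite -YE sym_extensionE ?pi_swap_gen // -tpermJ -conjgC wd_row.
  have [hs _ _] := iota_weyl (sym_extension gen).
  rewrite (symtens_fixge (wd s) hs (fixge_tperm xm ym)) pmulrn raddfMz ffunMzE -/X0 GE.
  set z := (iota _) _; rewrite mulrzz PoszM => e.
  by apply/dvdzP; exists z; lia.
exists X'; split=> // y hy; apply/eqP; rewrite -subr_eq0; apply/eqP.
apply: (tens_torsionfree G0'); rewrite mulrzBl -mulrzA.
have -> : (sigma y *: X') *~ G' = sigma y *: X0 by rewrite /X0 XE scalerMzr.
by rewrite -YE sym_extensionE // [H y *+ _]pmulrn raddfMz GE PoszM mulrC subrr.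
Qed.

Definition half_image X := forall y, pi y = 0 -> iota (H y) *~ 2 = sigma y *: X.

(** Exchanging places within the row or the column changes a coefficient at most by a sign.
    Exchanging letters preserves its parity, since [sigma (swap_gen p q) *: X] is twice a tensor. *)
Lemma half_parity X : weyl mu X -> half_image X ->
  forall s s', zeros s = zeros s' -> (2 %| X (wd s))%Z = (2 %| X (wd s'))%Z.
Proof.
move=> [hs ha _] hX; apply: (double_coset_invariant amu mur) => s p q pq.
  rewrite wd_row; have [->|npq] := eqVneq p q; first by rewrite tperm1 permidx1.
  case: (ltnP p mu) pq => pm /esym qm; first by rewrite (symtens_fixge _ hs) ?fixge_tperm.
  by rewrite (antisym_tperm _ ha) // ?rpredN // leqNgt qm.
have [->|npq] := eqVneq p q; first by rewrite tperm1 mulg1.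
case: (ltnP p a) pq => pm /esym qm; first by rewrite wd_fixge ?fixge_tperm.
have qa : (a <= q)%N by rewrite leqNgt qm.
have := sigma_swap_gen X s pm qa npq.
rewrite -hX ?pi_swap_gen // ffunMzE mulrzz => e.
have e2 : (2 %| X (wd s) + X (wd (s * tperm p q)%g))%Z by rewrite -e dvdz_mull.
by apply/idP/idP => h; [rewrite -(rpredDr _ h)|rewrite -(rpredDl _ h)].
Qed.

Lemma half_even_extends X : weyl mu X -> supported X -> half_image X ->
  (forall s, zeros s = 1%N -> (2 %| X (wd s))%Z) -> extends pi H.
Proof.
move=> wX sX hX h1; have [X' [wX' _ XE]] := weyl_divisible (d := 2) isT wX sX h1.
have [w wE] := iota_surj wX'.
exists (fun y => sigma y *: w); first exact: linear_sigma.
move=> y hy; apply: iota_inj; apply/eqP; rewrite -subr_eq0; apply/eqP.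
apply: (@tens_torsionfree _ 2) => //; rewrite mulrzBl hX // XE linearZ /= wE.
by rewrite scalerMzr subrr.
Qed.

Lemma klinear_dichotomy : extends pi H \/ exists X, [/\ weyl mu X, supported X,
  half_image X & forall s, zeros s = 1%N -> (2 %| X (wd s) - 1)%Z].
Proof.
have [X [wX sX hX]] := klinear_half.
have [h1|/existsNP[s1 /not_implyP[z1 /negP n1]]] :=
  pselect (forall s, zeros s = 1%N -> (2 %| X (wd s))%Z).
  by left; apply: half_even_extends hX h1.
right; exists X; split=> // s z.
move: n1; rewrite -(half_parity wX hX (etrans z (esym z1))).
by move: (X (wd s)) => x; lia.
Qed.

End KLinear.

(** * The parity condition *)

Definition one_zero : 'S_r := tperm (Ordinal (leq_ltn_trans (leq0n mu) mur)) (Ordinal mur).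

Lemma one_zeroE q : (mu <= q)%N -> one_zero q =
  if q == Ordinal mur then Ordinal (leq_ltn_trans (leq0n mu) mur) else q.
Proof.
move=> mq; have [->|qm] := eqVneq q (Ordinal mur); first by rewrite tpermR.
rewrite tpermD // 1?eq_sym //.
by apply: contraTneq mq => ->; rewrite -ltnNge /=; exact: leq_ltn_trans amu.
Qed.

Lemma zeros_one_zero : zeros one_zero = 1%N.
Proof.
rewrite -(card1 (Ordinal mur)); apply: eq_card => q; rewrite !inE.
case: (leqP mu q) => /= [mq|qm]; last by case: eqP qm => // ->; rewrite ltnn.
by rewrite one_zeroE //; case: ifP => //= _; rewrite ltnNge (leq_trans (ltnW amu)).
Qed.

Lemma zeros1_one_zero : zeros1 a mu one_zero = 1%N.
Proof.
rewrite -(card1 (Ordinal mur)); apply: eq_card => q; rewrite !inE.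
case: (leqP mu q) => /= [mq|qm]; last by case: eqP qm => // ->; rewrite ltnn.
by rewrite one_zeroE //; case: ifP => //= _; rewrite leqNgt (leq_trans amu).
Qed.

Let an1 : (r - a.+1 <= n)%N. Proof. exact: leq_trans (leq_sub2l _ (leqnSn a)) an. Qed.

Definition omega : P := up (ebas (hw n r a.+1)).

Lemma omegaE : lsub_val omega = ebas (hw n r a.+1).
Proof. by apply: upK; apply: symtensS; apply: hw_symtens. Qed.

Lemma pi_omega : pi omega = 0.
Proof. by apply: pi_symtens; rewrite omegaE hw_symtens. Qed.

(** If the coefficients were odd, then [sigma omega *: X] would have a coefficient congruent to (r -
    mu) + a modulo 2 at a word with [zeros1] equal to 1; but it is twice a tensor. *)
Lemma odd_all_extend (H : P -> N) : klinear pi H -> odd (r - mu + a) -> extends pi H.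
Proof.
move=> HK odd_rma; have [//|[X [wX _ hX h1]]] := klinear_dichotomy HK; exfalso.
have := omega_parity amu mur one_zero (weyl_parity a0 amu mur an wX h1).
rewrite -(sigma_omega amu mur an X one_zero omegaE) -hX ?pi_omega // ffunMzE mulrzz.
rewrite zeros1_one_zero /kappa /= subSS subn0; set z := (iota _) _; move: odd_rma; lia.
Qed.

(** The parity of X depends only on the number of column zeros, which an exchange of two nonzero
    letters preserves. For a generator symmetric in [p] and [q], this exchange pairs congruent terms
    and fixes no rearrangement of [hw a]. *)
Lemma sigma_even_alttens X y : (forall s, (2 %| X (wd s) - kappa r mu (zeros s))%Z) ->
  lsub_val y \in alttens a -> forall i, (2 %| (sigma y *: X) i)%Z.
Proof.
(* [sigma_fun] replaces [sigma] here so that [Q] makes sense for every tensor. *)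
move=> hX hy; pose Q t := forall i, (2 %| \sum_j sigma_fun a t (i, j) * X j)%Z.
have sfB t u ij : sigma_fun a (t - u) ij = sigma_fun a t ij - sigma_fun a u ij.
  by rewrite !ffunE; case: pickP => [s _|_]; rewrite ?subrr // tensD tensN.
suff : Q (lsub_val y) by move=> h i; rewrite tens_scaleE; exact: h.
apply: (alt_kernel_ind (c := a) (Q := Q)) (lsub_valP y) (alt_alttens hy).
- by move=> i; rewrite big1 ?dvdz0 // => j _; rewrite -[0 : T](subrr 0) sfB subrr mul0r //.
- move=> t u ht hu i; under eq_bigr do rewrite sfB mulrBl.
  by rewrite sumrB rpredB.
move=> u p q hu ap aq pq upq i.
pose rho := tperm (hw n r a p) (hw n r a q).
have wdpi s : letters rho (wd s) = wd (s * tperm p q)%g.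
  apply/ffunP=> x; rewrite ffunE [permidx _ _ x]ffunE [RHS]ffunE letters_hw //.
  by rewrite permM.
have rhoK : involutive (letters rho : I -> I).
  by move=> j; apply/ffunP=> x; rewrite !ffunE tpermK.
have sF s : sigma_fun a u (i, wd (s * tperm p q)%g) = sigma_fun a u (i, wd s).
  by rewrite !sigma_funE // invMg tpermV -permidxM upq.
have out j : (forall s, wd s != j) -> forall s, wd s != letters rho j.
  move=> nj s; apply: contra (nj (s * tperm p q)%g) => /eqP e.
  by rewrite -wdpi e rhoK.
apply: (sum_involution_even rhoK) => j; have [[s <-]|nj] := hw_orbitP a j.
- rewrite wdpi sF -mulrBr dvdz_mull //.
  rewrite -[_ - _](subrKA (kappa r mu (zeros s))) rpredD //; last by rewrite -opprB rpredN.
  by rewrite -(zeros_fixlt mu s (fixlt_tperm ap aq)).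
- by rewrite !sigma_fun_out ?mul0r ?subrr //; exact: out.
- rewrite wdpi => /eqP; rewrite eq_sym hw_eq // mulKg => /fixgeP/(_ p ap)/eqP.
  by rewrite tpermL eq_sym (negbTE pq).
- by rewrite sigma_fun_out ?mul0r.
Qed.

Lemma sigma_even_ker X y : (forall s, (2 %| X (wd s) - kappa r mu (zeros s))%Z) ->
  ~~ odd (r - mu + a) -> pi y = 0 -> forall i, (2 %| (sigma y *: X) i)%Z.
Proof.
move=> hX ev /ker_decomp[y1 [y2 [-> h1 h2]]] i.
rewrite -[y1]scale1r sigma_linear mul1r scalerDl tensD rpredD //.
  exact: sigma_even_alttens.
pose y' : lsub (@symtens n.+1 r a.+1) := Lsub h2.
have [A yA] := ex_intro (fun A => A *: _ = _) _ (sigmaK an1 y').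
have -> : y2 = A *: omega.
  apply: val_inj; rewrite [RHS](linearZ_LR (@lsub_val _ _ _)) /= omegaE.
  by rewrite -[LHS](congr1 (@lsub_val _ _ _) yA).
have sZ (B : S) v : sigma (B *: v) = B * sigma v.
  have s0 : sigma 0 = 0.
    have := sigma_linear an (-1) 0 0.
    by rewrite !scaleN1r oppr0 addr0 mulN1r addNr.
  by rewrite -[B *: v]addr0 sigma_linear s0 addr0.
rewrite sZ -scalerA tens_scaleE; apply: rpred_sum => j _; apply: dvdz_mull.
have [[s <-]|nj] := hw_orbitP a.+1 j; last by rewrite (sigma_omega_out _ _ omegaE) ?dvdz0.
have := omega_parity amu mur s hX; rewrite (sigma_omega amu mur an X s omegaE).
have zle : (zeros1 a mu s <= a.+1)%N.
  rewrite -(card_perm_ltn s (a_lt_r amu mur)); apply: subset_leq_card.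
  by apply/fintype.subsetP => q; rewrite !inE => /andP[].
move: (zeros1 a mu s) zle => z zle; set x := \sum_(l < r | _) _.
suff : (2 %| kappa r mu z.-1 *+ z + kappa r mu z *+ (a.+1 - z))%Z.
  by move=> h hx; rewrite -[x](subrK (kappa r mu z.-1 *+ z + kappa r mu z *+ (a.+1 - z))) rpredD.
(* For z = 0, 1, 2 the values are (r - mu)(a + 1), r - mu + a and 2, and beyond that 0: all even
   when r - mu and a have the same parity. *)
case: z zle => [|[|[|z]]] zle; rewrite /kappa /= ?mul0rn ?mulr0n ?addr0 ?add0r //.
  rewrite subn0 pmulrn mulrzz -PoszM dvdzE dvdn2 oddM; move: ev; rewrite oddD /=.
  by case: odd; case: odd.
rewrite subSS subn0 mulr1n [_ *+ a]pmulrn mulrzz -PoszM -PoszD mul1n dvdzE dvdn2; exact: ev.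
Qed.

Lemma even_nontrivial : ~~ odd (r - mu + a) -> exists h0 : P -> N,
  [/\ klinear pi h0, ~ extends pi h0 &
      forall h : P -> N, klinear pi h -> extends pi h \/ extends pi (fun y => h y - h0 y)].
Proof.
move=> ev; have [w0 ww0 hw0] := weyl_odd_exists a0 amu mur an.
(* Applying [sigma gen] moves the vector into the weight space without changing its coefficients at
   rearrangements of [hw a]. *)
have [m0 mE] := iota_surj ww0.
pose w := iota (sigma gen *: m0).
have ww : weyl mu w by exact: iota_weyl.
have wE : w = sigma gen *: w0 by rewrite /w linearZ /= mE.
have sw : supported w by rewrite wE; exact: sigma_gen_supported.
have w1 s : zeros s = 1%N -> (2 %| w (wd s) - 1)%Z by move=> z; rewrite wE sigma_gen_wd hw0.
have half y : pi y = 0 -> exists m, iota m *~ 2 = sigma y *: w.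
  move=> hy; have hev := sigma_even_ker (weyl_parity a0 amu mur an ww w1) ev hy.
  pose X : T := [ffun i => ((sigma y *: w) i %/ 2)%Z].
  have XE : X *~ 2 = sigma y *: w.
    by apply: tensP => i; rewrite ffunMzE ffunE mulrzz divzK.
  have wX : weyl mu X.
    by apply: (@weyl_divz _ 2) => //; rewrite XE /w -linearZ; exact: iota_weyl.
  by have [m mX] := iota_surj wX; exists m; rewrite mX.
(* The half is unique because N is torsion-free, which makes [h0] linear on the kernel; the value 0
   elsewhere is a filler. *)
pose h0 y := if pselect (pi y = 0) is left e then projT1 (cid (half y e)) else 0.
have h0E y : pi y = 0 -> iota (h0 y) *~ 2 = sigma y *: w.
  by move=> hy; rewrite /h0; case: pselect => // e; exact: projT2 (cid (half y e)).
have inj2 (x z : N) : iota x *~ 2 = iota z *~ 2 -> x = z.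
  move=> e; apply: iota_inj; apply/eqP; rewrite -subr_eq0; apply/eqP.
  by apply: (@tens_torsionfree _ 2) => //; rewrite mulrzBl e subrr.
have kh0 : klinear pi h0.
  move=> A y v hy hv; apply: inj2; rewrite h0E; last by rewrite linearP /= hy hv scaler0 addr0.
  rewrite linearP /= mulrzDl scalerMzr !h0E // sigma_linear.
  by rewrite scalerDl scalerA.
exists h0; split=> //.
(* If [g] extended [h0], the elements [swap_gen] would annihilate [w - 2 g(gen)]. Exchanging two
   letters of the row then gives coefficient 0 at a word with one column zero, where [w] is odd. *)
- move=> [g lg hg].
  have gE y : g y = sigma y *: g gen by exact: hom_sigma.
  pose s := one_zero; have z1 := zeros_one_zero.
  have [x [z [xm zm ax az xz]]] := zeros1_rows amu mur z1.
  have sxz : s x != s z by apply: contra xz => /eqP/perm_inj ->.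
  pose D := w - iota (g gen) *~ 2.
  have := sigma_swap_gen D s ax az sxz.
  rewrite -tpermJ -conjgC wd_row.
  have wD : weyl mu D by apply: weylB => //; rewrite -raddfMz; exact: iota_weyl.
  have [hs _ _] := wD; rewrite (symtens_fixge (wd s) hs (fixge_tperm xm zm)).
  rewrite scalerBr -h0E ?pi_swap_gen // hg ?pi_swap_gen // gE linearZ /= scalerMzr subrr ffunE.
  move=> e; have : D (wd s) = 0 by move: e; move: (D (wd s)) => d; lia.
  rewrite /D tensD tensN ffunMzE mulrzz; have := w1 s z1.
  by move: (w (wd s)) (iota (g gen) (wd s)) => c d; lia.
(* At words with one column zero both X and [w] are odd, so the vector [X - w] attached to [h - h0]
   is even there. *)
- move=> h kh; have [|[X [wX sX hX h1]]] := klinear_dichotomy kh; [by left|right].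
  apply: (half_even_extends (X := X - w)).
  - exact: weylB.
  - by move=> i ni; rewrite tensD tensN sX // sw // subrr.
  - by move=> y hy; rewrite linearB /= mulrzBl hX // h0E // scalerBr.
  - move=> s z; rewrite tensD tensN; have := w1 s z; have := h1 s z.
    by move: (X (wd s)) (w (wd s)) => c d; lia.
Qed.
End ExtComputation.

Theorem theorem3p5 (n a b k : nat) :
  (1 <= a)%N -> (2 <= k)%N -> (k <= b)%N -> (b + 1 <= n)%N ->
  let E := Ext (hookWeyl n (a + b) a) (hookWeyl n (a + b) (a + k)) 1 in
  (~~ odd (a + b + k) -> forall x : E, x = 0) /\
  (odd (a + b + k) -> exists f : {additive E -> 'Z_2}, bijective f).
Proof.
move=> a1 k2 kb; case: n => [|n bn]; first by rewrite addn1.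
(* Delta(h(k)) embeds by alternating from place mu = a + k - 1 on. Then r - mu + a = a + b - k + 1,
   of parity opposite to a + b + k. *)
have amu : (a < (a + k).-1)%N by lia.
have mur : ((a + k).-1 < a + b)%N by lia.
have an : (a + b - a <= n)%N by rewrite addKn -ltnS -addn1.
have akE : (a + k = (a + k).-1.+1)%N by lia.
have [pi [pi_surj piP]] := hookWeyl_presentation n.+1 (a_lt_r amu mur).
have mu0 : (0 < (a + k).-1)%N by exact: leq_ltn_trans amu.
have [iota [iota_inj iota_weyl iota_surj]] := hookWeyl_embedding n.+1 mu0 mur.
rewrite akE /=; split=> par.
  apply: (Ext1_trivial pi_surj (sigma_linear an) (sigmaK an)) => h kh.
  by apply: (odd_all_extend a1 amu mur an piP iota_inj iota_weyl iota_surj kh); lia.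
have [|h0 [kh0 nh0 h0P]] :=
  even_nontrivial a1 amu mur an piP iota_inj iota_weyl iota_surj; first lia.
exact: (Ext1_Z2 pi_surj (sigma_linear an) (sigmaK an) kh0 nh0 h0P).
Qed.
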